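(* For every real $\alpha \in (0,1)$ we have $$ f(\alpha) = \min\Big(1,\ \min_{\ell} \max\Big(2\ell \alpha, \frac{1}{\ell}\Big)\Big), $$ where the inner minimum is taken over all positive integers $\ell$.
   Context: For a prime $p$, $\mathbb{F}_p$ is the finite field with $p$ elements. For $A \subset \mathbb{F}_p$, $A+A = \{a+b : a,b\in A\}$ and $A\cdot A = \{ab : a,b \in A\}$. For fixed $\alpha\in(0,1)$ define $$ f(\alpha) = \liminf_{p\to\infty}\ \min_{A\subset \mathbb{F}_p,\ |A|\ge \alpha p}\ \frac{\max(|A+A|,|A\cdot A|)}{p}, $$ where $p$ runs over the primes. *)

(* Defs.v *)
From mathcomp Require Import all_boot all_order all_algebra.
From mathcomp Require Import all_classical all_reals all_analysis.

Set Implicit Arguments.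
Unset Strict Implicit.
Unset Printing Implicit Defensive.

Import Order.TTheory GRing.Theory Num.Theory.

Local Open Scope classical_set_scope.
Local Open Scope ring_scope.

Definition sumset (p : nat) (A : {set 'F_p}) : {set 'F_p} :=
  [set x + y | x in A, y in A]%SET.

Definition prodset (p : nat) (A : {set 'F_p}) : {set 'F_p} :=
  [set x * y | x in A, y in A]%SET.

(* The minimum is over a finite family, nonempty when alpha <= 1 and p is
   prime; +oo is the neutral element of min on \bar R. *)
Definition min_ratio (R : realType) (alpha : R) (p : nat) : \bar R :=
  \big[Order.min/+oo%E]_(A : {set 'F_p} | alpha * p%:R <= #|A|%:R)
    ((maxn #|sumset A| #|prodset A|)%:R / p%:R)%:E.

(* 'F_p is the field with p elements only for p prime; the filter discards
   all other values of p. *)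
Definition sum_product_liminf (R : realType) (alpha : R) : \bar R :=
  limf_einf (min_ratio alpha) (within [set p | prime p] \oo).

Definition is_minimum (R : realType) (S : set R) (m : R) : Prop :=
  S m /\ lbound S m.

(* Main.v *)
Require Import Defs.
From mathcomp Require Import all_classical all_reals all_analysis.
(* Imported last so that the finite-set names are not shadowed by those of
   [classical_sets]. *)
From mathcomp Require Import all_boot all_order all_algebra.
From mathcomp Require Import all_fingroup all_field all_character.
From mathcomp Require Import zify ring lra.

(** Upper bound: for a prime [p = 1 mod l], some coset of the subgroup of index
    [l] of [F_p^*] meets an interval of length about [l alpha p] in at least
    [alpha p] points; this intersection [A] has [|A + A| <= 2 l alpha p] and
    [|AA| <= p / l], asymptotically.

    Lower bound: put [D = A + A] and [E = AA]. Enlarge [A] to a set [P] almost all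
    of whose sums lie in [D], and to a set [Q] almost all of whose products lie in
    [E]. Up to a small error the indicator function of [P] is a polynomial in
    additive correlations, so its additive Fourier transform has bounded l1 norm;
    likewise for [Q] and multiplicative characters. The square-root bound for
    Gauss sums then makes [P] and [Q] asymptotically independent, whence
    [(|P|/p) (|Q|/p) >= alpha - o(1)]. Pollard's theorem gives
    [|D| >= min(p, 2|P|) - o(p)]. Freiman's 3/2 theorem, in a form which tolerates
    few exceptional products, gives [|E| >= p/l - o(p)] as soon as
    [|Q| > (1/(l+1) + o(1)) p]. *)

Set Implicit Arguments.
Unset Strict Implicit.
Unset Printing Implicit Defensive.

Import Order.TTheory GRing.Theory Num.Theory.

Local Open Scope ring_scope.

(** * Fourier analysis on finite abelian groups *)

(* [C] bounds the l1 norm of the Fourier transform of [u]. *)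
Definition wiener (gT : finGroupType) (C : algC) (u : gT -> algC) : Prop :=
  exists (I : finType) (c : I -> algC) (chi : I -> 'CF([set: gT])),
  [/\ forall i, chi i \is a linear_char,
      forall x, u x = \sum_i c i * chi i x
    & \sum_i `|c i| <= C].

Lemma wiener_const1 (gT : finGroupType) : @wiener gT 1 (fun=> 1).
Proof.
exists unit, (fun=> 1), (fun=> 1); split=> [_|x|].
- exact: cfun1_lin_char.
- by rewrite big_const card_unit /= addr0 mul1r cfun1E inE.
- by rewrite big_const card_unit /= addr0 normr1.
Qed.

Lemma wiener_mul (gT : finGroupType) (C C' : algC) (u v : gT -> algC) :
  wiener C u -> wiener C' v -> wiener (C * C') (fun x => u x * v x).
Proof.
move=> [I [c [chi [chiL uE cC]]]] [J [d [psi [psiL vE dC]]]].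
exists (I * J)%type, (fun k => c k.1 * d k.2), (fun k => chi k.1 * psi k.2).
split=> [[i j]|x|].
- exact: rpredM.
- rewrite uE vE big_distrlr pair_bigA; apply: eq_bigr => k _.
  by rewrite cfunE mulrACA.
- rewrite (eq_bigr (fun k => `|c k.1| * `|d k.2|)) => [|k _]; last by rewrite normrM.
  rewrite -(pair_bigA _ (fun i j => `|c i| * `|d j|)) -big_distrlr.
  by apply: ler_pM => //; apply: sumr_ge0 => i _; apply: normr_ge0.
Qed.

Lemma wiener_exp (gT : finGroupType) (C : algC) (u : gT -> algC) (k : nat) :
  wiener C u -> wiener (C ^+ k) (fun x => u x ^+ k).
Proof.
move=> uC; elim: k => [|k IHk]; first exact: wiener_const1.
have [I [c [chi [chiL uE cC]]]] := wiener_mul uC IHk.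
by exists I, c, chi; split => // [x|]; rewrite exprS.
Qed.

(* With hat denoting Fourier coefficients, the function is the inverse
   transform of [#|G| * hat(1_Y) * conj hat(1_X)], and Parseval and AM-GM bound
   its l1 norm by [#|G| * (|X| + |Y|) / (2 #|G|) <= #|G|]. *)
Lemma wiener_correlation (gT : finGroupType) (X Y : {set gT}) :
  abelian [set: gT] ->
  wiener #|gT|%:R (fun x => #|[set a in X | (x * a)%g \in Y]|%:R).
Proof.
move=> abG; pose G := [set: gT]%G.
have nG (A : {set gT}) : normal A G.
  rewrite /normal subsetT /=; apply/subsetP => x _; rewrite inE.
  apply/subsetP => _ /imsetP[y Ay ->].
  have xy : commute x y by apply: (centsP abG); rewrite inE.
  by rewrite conjgE -xy mulKg.
pose hat (A : {set gT}) (i : Iirr G) := '[ '1_A, 'chi_i].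
have chiL := char_abelianP _ abG.
have N0 : #|gT|%:R != 0 :> algC by rewrite pnatr_eq0 -lt0n -cardsT cardG_gt0.
have hatE A i : hat A i = #|gT|%:R^-1 * \sum_(y in A) ('chi_i y)^*.
  rewrite /hat cfdotE cardsT; congr (_ * _).
  rewrite [RHS]big_mkcond /=; apply: eq_big => [y|y _]; first by rewrite inE.
  by rewrite cfuniE //; case: ifP; rewrite ?mul1r ?mul0r.
have parseval A : \sum_i `|hat A i| ^+ 2 = #|A|%:R / #|gT|%:R.
  have := cfnormE (cfuni_on G A); rewrite cfdot_sum_irr => E.
  transitivity (\sum_(i : Iirr G) '['1_A, 'chi_i] * ('['1_A, 'chi_i])^*).
    by apply: eq_bigr => i _; rewrite -normCK.
  rewrite E cardsT mulrC; congr (_ / _).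
  rewrite -sum1_card natr_sum; apply: eq_bigr => y Ay.
  by rewrite cfuniE // Ay normr1 expr1n.
exists (Iirr G), (fun i => #|gT|%:R * hat Y i * (hat X i)^*), (fun i => 'chi_i).
split=> [||].
- exact: chiL.
- move=> x.
  have -> : #|[set a in X | (x * a)%g \in Y]|%:R
     = \sum_(a in X) ('1_Y : 'CF(G)) (x * a)%g.
    rewrite -sum1_card natr_sum big_mkcond [RHS]big_mkcond /=.
    by apply: eq_bigr => a _; rewrite inE cfuniE //; case: (a \in X) => //=; case: ifP.
  rewrite (eq_bigr (fun a => \sum_i hat Y i * ('chi_i x * 'chi_i a))); last first.
    move=> a _; rewrite {1}(cfun_sum_cfdot ('1_Y : 'CF(G))) sum_cfunE.
    by apply: eq_bigr => i _; rewrite cfunE lin_charM ?inE.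
  rewrite exchange_big; apply: eq_bigr => i _ /=.
  rewrite [hat X i]hatE rmorphM rmorph_sum /= fmorphV rmorph_nat.
  under [in RHS]eq_bigr => y _ do rewrite conjCK.
  by rewrite -mulr_sumr -mulr_sumr; move: (\sum_(_ in X) _) => s; field.
- have amgm i : `|#|gT|%:R * hat Y i * (hat X i)^*| <=
       #|gT|%:R / 2 * (`|hat Y i| ^+ 2 + `|hat X i| ^+ 2).
    move: (hat Y i) (hat X i) => y x.
    rewrite !normrM norm_conjC normr_nat -!mulrA ler_pM2l ?lt0r ?N0 ?ler0n //.
    rewrite [leRHS]mulrC.
    by case: (real_leif_mean_square (normr_real y) (normr_real x)).
  apply: le_trans (ler_sum _ (fun i _ => amgm i)) _.
  rewrite -mulr_sumr big_split /= !parseval -mulrDl.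
  have -> : #|gT|%:R / 2 * ((#|Y|%:R + #|X|%:R) / #|gT|%:R) = (#|Y| + #|X|)%:R / 2 :> algC.
    by rewrite natrD; field.
  rewrite ler_pdivrMr ?ltr0n // -natrM ler_nat muln2 -addnn.
  by rewrite leq_add ?max_card.
Qed.

Lemma sum_lin_char_nontrivial (gT : finGroupType) (e : 'CF([set: gT])) (z : gT) :
  e \is a linear_char -> e z != 1 -> \sum_x e x = 0.
Proof.
move=> eL ez1; apply/eqP; suff: (e z - 1) * (\sum_x e x) == 0.
  by rewrite mulf_eq0 subr_eq0 (negPf ez1).
rewrite mulrBl mul1r subr_eq0 mulr_sumr; apply/eqP.
rewrite [RHS](reindex_inj (mulgI z)); apply: eq_bigr => x _.
by rewrite lin_charM ?inE.
Qed.

(** * Gauss sums and the decorrelation of additive and multiplicative characters *)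

Section GaussSums.
Variables (F : finFieldType) (e : 'CF([set: F])) (psi : 'CF([set: {unit F}])).
Hypotheses (eL : e \is a linear_char) (psiL : psi \is a linear_char).

Let lin_addr x y : e (x + y) = e x * e y.
Proof. by rewrite -[x + y]/((x * y)%g) lin_charM ?inE. Qed.

Let lin_oppr x : e (- x) = (e x)^*.
Proof. by rewrite -[- x]/((x^-1)%g) lin_charV_conj ?inE. Qed.

Let gauss (xi : F) := \sum_(x : {unit F}) e (xi * val x) * psi x.

(* Multiplying the frequency [xi] by a unit does not change [|gauss xi|], and
   Parseval gives the mean square of [gauss] over all frequencies. *)
Lemma gauss_sum_bound (z : F) : e z != 1 ->
  `|\sum_(x : {unit F}) e (val x) * psi x| ^+ 2 <= #|F|%:R.
Proof.
move=> ez1; pose n := #|{: {unit F}}|.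
have n_gt0 : (0 < n)%N by rewrite /n -cardsT cardG_gt0.
have meansq : \sum_xi `|gauss xi| ^+ 2 = #|F|%:R * n%:R.
  transitivity (\sum_xi \sum_(x : {unit F}) \sum_(y : {unit F})
      psi x * (psi y)^* * e (xi * (val x - val y))).
    apply: eq_bigr => xi _; rewrite normCK /gauss rmorph_sum /= big_distrlr /=.
    apply: eq_bigr => x _; apply: eq_bigr => y _.
    rewrite rmorphM /=. rewrite -lin_oppr mulrBr lin_addr /=; ring.
  rewrite exchange_big /= (eq_bigr (fun=> #|F|%:R)) => [|x _].
    by rewrite sumr_const mulr_natr.
  (* The diagonal [y = x] contributes [#|F|]; off it, rescaling [xi] gives a full sum of [e], which
     vanishes. *)
  rewrite exchange_big (bigD1 x) //= [X in _ + X]big1 ?addr0 => [|y yx].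
    rewrite subrr (eq_bigr (fun=> 1)) ?sumr_const // => xi _.
    rewrite mulr0 -normCK normC_lin_char ?inE // expr1n mul1r.
    by rewrite -[0]/(1%g : F) lin_char1.
  rewrite -mulr_sumr; have d0 : val x - val y != 0.
    by rewrite subr_eq0 eq_sym; apply: contraNneq yx => /val_inj ->.
  rewrite (reindex_inj (mulIf (invr_neq0 d0))) /=.
  under eq_bigr do rewrite mulfVK //.
  by rewrite (sum_lin_char_nontrivial eL ez1) mulr0.
have gaussJ (u : {unit F}) : `|gauss (val u)| = `|gauss 1|.
  have uVxE (x : {unit F}) : val u * val (u^-1 * x)%g = val x.
    by rewrite FinRing.val_unitM FinRing.val_unitV mulVKr ?(valP u).
  rewrite /gauss (reindex_inj (mulgI u^-1%g)).
  under eq_bigr => x _ do rewrite uVxE lin_charM ?inE // mulrCA.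
  under [in RHS]eq_bigr => x _ do rewrite mul1r.
  by rewrite -mulr_sumr normrM normC_lin_char ?inE // mul1r.
have -> : \sum_(x : {unit F}) e (val x) * psi x = gauss 1.
  by apply: eq_bigr => x _; rewrite mul1r.
(* Frequency 0 is dropped; the [n] remaining terms are equal, so [n] cancels. *)
have: \sum_(u : {unit F}) `|gauss (val u)| ^+ 2 <= #|F|%:R * n%:R.
  rewrite -meansq -(big_imset (fun xi => `|gauss xi| ^+ 2)) /=; last first.
    by move=> u v _ _; apply: val_inj.
  rewrite [leRHS](bigID [in [set val u | u : {unit F}]]) /= lerDl.
  by apply: sumr_ge0 => xi _; rewrite exprn_ge0.
rewrite (eq_bigr (fun=> `|gauss 1| ^+ 2)) => [|u _]; last by rewrite gaussJ.
by rewrite sumr_const -[_ *+ _]mulr_natr ler_pM2r // ltr0n.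
Qed.

(** [s] is an integer stand-in for the square root of [#|F|]. For trivial [e] the two terms
    coincide; otherwise the sum of [e] vanishes and the Gauss sum bound applies. *)
Lemma char_correlation_bound (s : nat) : (#|F| <= s ^ 2)%N ->
  `|#|F|%:R * (\sum_(x : {unit F}) e (val x) * psi x)
    - (\sum_x e x) * (\sum_x psi x)| <= (#|F| * s)%:R.
Proof.
move=> qs; have [/forallP e1|/forallPn[z ez1]] := boolP [forall z, e z == 1].
  under eq_bigr do rewrite (eqP (e1 _)) mul1r.
  rewrite [in X in _ - X](eq_bigr (fun=> 1)) => [|x _]; last exact/eqP.
  by rewrite sumr_const subrr normr0 ler0n.
rewrite (sum_lin_char_nontrivial eL ez1) mul0r subr0 normrM normr_nat natrM.
rewrite ler_wpM2l ?ler0n // -(@ler_pXn2r _ 2) ?nnegrE ?ler0n //.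
by apply: le_trans (gauss_sum_bound ez1) _; rewrite -natrX ler_nat.
Qed.

End GaussSums.

(** The difference is bilinear in [u] and [v], so it suffices to bound it for each pair of
    characters and to sum the absolute values of the coefficients. *)
Lemma wiener_decorrelation (F : finFieldType) (s : nat) (C C' : algC)
    (u : F -> algC) (v : {unit F} -> algC) :
  (#|F| <= s ^ 2)%N -> wiener C u -> wiener C' v ->
  `|#|F|%:R * (\sum_(x : {unit F}) u (val x) * v x)
    - (\sum_x u x) * (\sum_x v x)| <= (#|F| * s)%:R * (C * C').
Proof.
move=> qs [I [c [chi [chiL uE cC]]]] [J [d [psi [psiL vE dC]]]].
have -> : #|F|%:R * (\sum_(x : {unit F}) u (val x) * v x)
    - (\sum_x u x) * (\sum_x v x) =
  \sum_i \sum_j c i * d j *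
    (#|F|%:R * (\sum_(x : {unit F}) chi i (val x) * psi j x)
     - (\sum_x chi i x) * (\sum_x psi j x)).
  under [in RHS]eq_bigr => i _ do under eq_bigr => j _ do rewrite mulrBr.
  under [in RHS]eq_bigr => i _ do rewrite sumrB.
  rewrite sumrB; congr (_ - _).
    under eq_bigr => x _ do rewrite uE vE big_distrlr.
    rewrite exchange_big mulr_sumr; apply: eq_bigr => i _ /=.
    rewrite exchange_big mulr_sumr; apply: eq_bigr => j _ /=.
    rewrite mulrCA; congr (_ * _); rewrite mulr_sumr.
    by apply: eq_bigr => x _; rewrite mulrACA.
  under eq_bigr => x _ do rewrite uE.
  under [in X in _ * X]eq_bigr => x _ do rewrite vE.
  rewrite exchange_big [in X in _ * X]exchange_big big_distrlr /=.
  apply: eq_bigr => i _; apply: eq_bigr => j _.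
  by rewrite -!mulr_sumr mulrACA.
apply: le_trans (ler_norm_sum _ _ _) _.
apply: (@le_trans _ _ (\sum_i \sum_j `|c i| * `|d j| * (#|F| * s)%:R)).
  apply: ler_sum => i _; apply: le_trans (ler_norm_sum _ _ _) _.
  apply: ler_sum => j _; rewrite !normrM ler_wpM2l ?mulr_ge0 //.
  exact: char_correlation_bound.
under eq_bigr => i _ do rewrite -mulr_suml.
rewrite -mulr_suml -big_distrlr mulrC ler_wpM2l ?ler0n //.
by rewrite ler_pM // sumr_ge0.
Qed.

(** * Fattening a set along its sums or products *)

Definition correlation (gT : finGroupType) (X Y : {set gT}) (x : gT) : nat :=
  #|[set a in X | (x * a)%g \in Y]|.

Lemma correlation_le (gT : finGroupType) (X Y : {set gT}) x :
  (correlation X Y x <= #|X|)%N.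
Proof. by apply: subset_leq_card; apply/subsetP => a; rewrite inE => /andP[]. Qed.

Lemma correlation_full (gT : finGroupType) (X Y : {set gT}) x :
  (forall a, a \in X -> (x * a)%g \in Y) -> correlation X Y x = #|X|.
Proof.
move=> XY; apply: eq_card => a; rewrite inE.
by apply: andb_idr; apply: XY.
Qed.

Lemma correlation_sumC (gT : finGroupType) (X Y Z : {set gT}) :
  abelian [set: gT] ->
  (\sum_(z in Z) correlation X Y z = \sum_(x in X) correlation Z Y x)%N.
Proof.
move=> abG; have comm (x y : gT) : (x * y = y * x)%g.
  by apply: (centsP abG); rewrite inE.
have E (A B : {set gT}) : (\sum_(b in B) correlation A Y b =
    \sum_(b in B) \sum_(a in A) ((b * a)%g \in Y))%N.
  apply: eq_bigr => b _; rewrite /correlation -sum1_card big_mkcond [RHS]big_mkcond.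
  by apply: eq_bigr => a _; rewrite inE; case: (a \in A) => //=; case: ifP.
rewrite !E exchange_big /=; apply: eq_bigr => a _; apply: eq_bigr => b _.
by rewrite comm.
Qed.

Lemma bernoulli_ineq (R : realFieldType) (x : R) (k : nat) :
  0 <= x <= 1 -> 1 - k%:R * (1 - x) <= x ^+ k.
Proof.
move=> /andP[x0 x1]; elim: k => [|k IHk]; first by rewrite mul0r subr0 expr0.
have xk1 : x ^+ k <= 1 by rewrite exprn_ile1.
have : (1 - x) * x ^+ k <= 1 - x by rewrite ler_piMr ?subr_ge0.
rewrite mulrBl mul1r -exprS -natr1 mulrDl mul1r; lra.
Qed.

(* [P] consists of the [x] such that [x * a] and [x * s] lie in [D] for almost
   all [a] in [A] and [s] in [S], where [S] is itself the set of [x] such that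
   [x * a] lies in [D] for almost all [a] in [A]; high powers of the two
   correlations approximate the indicator function of [P]. *)
Lemma fattening (R : realFieldType) (d1 d2 eps : R) (k1 k2 : nat)
    (gT : finGroupType) (A D : {set gT}) :
  abelian [set: gT] -> (0 < #|A|)%N ->
  (forall x y, x \in A -> y \in A -> (x * y)%g \in D) ->
  0 <= d1 <= 1 -> 0 <= d2 <= 1 -> (1 - d1) ^+ k1 <= eps -> (1 - d2) ^+ k2 <= eps ->
  exists (P : {set gT}) (w : gT -> nat) (W : nat),
  [/\ wiener (#|gT| ^ (k1 + k2))%:R (fun x => (w x)%:R),
      (#|A| ^ (k1 + k2) <= W)%N /\ (forall x, w x <= W)%N,
      \sum_(x in A) (1 - (w x)%:R / W%:R) <= k2%:R * d1 * #|A|%:R,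
      \sum_x (w x)%:R / W%:R <= #|P|%:R + eps * #|gT|%:R
    & forall y, y \in P ->
      #|[set x in P | (y * x)%g \notin D]|%:R <= d2 * #|gT|%:R].
Proof.
move=> abG A0 AAD /andP[d10 d11] /andP[d20 d21] k1E k2E.
have leX (m n k : nat) : (m <= n -> m ^ k <= n ^ k)%N by case: k => // k; rewrite leq_exp2r.
pose f := correlation A D.
pose S := [set x | (1 - d1) * #|A|%:R <= (f x)%:R].
pose f' := correlation S D.
pose S' := [set x | (1 - d2) * #|S|%:R <= (f' x)%:R].
have fA x : x \in A -> f x = #|A|.
  by move=> Ax; apply: correlation_full => a; apply: AAD.
have AS : A \subset S.
  by apply/subsetP => x Ax; rewrite inE fA // ler_piMl ?ler0n // lerBlDr lerDl.
have leAS : (#|A| <= #|S|)%N by apply: subset_leq_card.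
have S0 : (0 < #|S|)%N by apply: leq_trans leAS.
pose W := (#|A| ^ k1 * #|S| ^ k2)%N.
pose w x := (f x ^ k1 * f' x ^ k2)%N.
have a0 : 0 < #|A|%:R :> R by rewrite ltr0n.
have s0 : 0 < #|S|%:R :> R by rewrite ltr0n.
pose r x : R := (f x)%:R / #|A|%:R.
pose r' x : R := (f' x)%:R / #|S|%:R.
have r01 x : 0 <= r x <= 1.
  by rewrite divr_ge0 ?ler0n //= ler_pdivrMr // mul1r ler_nat correlation_le.
have r'01 x : 0 <= r' x <= 1.
  by rewrite divr_ge0 ?ler0n //= ler_pdivrMr // mul1r ler_nat correlation_le.
have wE x : (w x)%:R / W%:R = r x ^+ k1 * r' x ^+ k2.
  by rewrite !natrM !natrX invfM mulrACA -!exprVn -!exprMn.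
exists (S :&: S'), w, W; split.
- have wf (X : {set gT}) := wiener_correlation X D abG.
  have := wiener_mul (wiener_exp k1 (wf A)) (wiener_exp k2 (wf S)).
  rewrite -exprD -natrX => -[I [c [chi [chiL uE cC]]]].
  by exists I, c, chi; split => // x; rewrite -uE /w natrM !natrX.
- split=> [|x]; first by rewrite expnD leq_mul // leX.
  by rewrite leq_mul // leX // correlation_le.
(* On [A] the ratio [r] equals 1, so only the power of [r'] loses mass, by Bernoulli's
   inequality. *)
- apply: (@le_trans _ _ (\sum_(x in A) k2%:R * (1 - r' x))).
    apply: ler_sum => x Ax; rewrite wE /r fA // divff ?gt_eqF // expr1n mul1r.
    by have := bernoulli_ineq k2 (r'01 x); rewrite lerBlDr lerBlDl addrC.
  rewrite -mulr_sumr -mulrA ler_wpM2l ?ler0n // sumrB sumr_const.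
  (* Double counting replaces the sum of [f'] over [A] by that of [f] over [S], where [f] is at
     least [(1 - d1) * #|A|]. *)
  rewrite /r' -mulr_suml -natr_sum correlation_sumC //.
  rewrite lerBlDr -lerBlDl -[X in X - _]mul1r -mulrBl ler_pdivlMr // natr_sum.
  apply: le_trans (ler_sum (F := fun=> (1 - d1) * #|A|%:R) _ _) => [|x]; last by rewrite inE.
  by rewrite sumr_const -[leRHS]mulr_natr.
- rewrite (bigID (mem (S :&: S'))) /=; apply: lerD.
    rewrite -sum1_card natr_sum; apply: ler_sum => x _; rewrite wE.
    by rewrite mulr_ile1 ?exprn_ge0 ?exprn_ile1 //; case/andP: (r01 x); case/andP: (r'01 x).
  have eps0 : 0 <= eps by apply: le_trans k1E; rewrite exprn_ge0 // subr_ge0.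
  (* Outside [S :&: S'] one of the two powers is at most [eps], the other at most 1. *)
  apply: (@le_trans _ _ (\sum_(x | x \notin S :&: S') eps)).
    apply: ler_sum => x; rewrite wE !inE negb_and -!ltNge.
    have /andP[rx0 rx1] := r01 x; have /andP[r'x0 r'x1] := r'01 x.
    case/orP=> h.
      rewrite -[leRHS]mulr1 ler_pM ?exprn_ge0 ?exprn_ile1 //.
      apply: le_trans k1E; apply: lerXn2r; rewrite ?nnegrE ?subr_ge0 //.
      by rewrite ler_pdivrMr // ltW.
    rewrite -[leRHS]mul1r ler_pM ?exprn_ge0 ?exprn_ile1 //.
    apply: le_trans k2E; apply: lerXn2r; rewrite ?nnegrE ?subr_ge0 //.
    by rewrite ler_pdivrMr // ltW.
  by rewrite sumr_const -[leLHS]mulr_natr ler_wpM2l // ler_nat max_card.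
- move=> y; rewrite !inE => /andP[_]; rewrite mulrBl mul1r => yS'.
  pose B := [set a in S | (y * a)%g \in D].
  have BS : B \subset S by apply/subsetP => a; rewrite inE => /andP[].
  have : (#|[set x in S :&: S' | (y * x)%g \notin D]| + f' y <= #|S|)%N.
    rewrite -(cardsID B S) (setIidPr BS) addnC leq_add2l subset_leq_card //.
    by apply/subsetP => x; rewrite !inE => /andP[/andP[-> _] ->].
  rewrite -(ler_nat R) natrD => h.
  have : d2 * #|S|%:R <= d2 * #|gT|%:R by rewrite ler_wpM2l // ler_nat max_card.
  lra.
Qed.

Lemma card_unit_le (F : finFieldType) : (#|{: {unit F}}| <= #|F|)%N.
Proof. exact: (leq_card (fun u : {unit F} => val u) val_inj). Qed.

(** A one-sided bound in natural numbers carries the estimate from [algC] to any real field. *)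
Lemma wiener_decorrelation_nat (F : finFieldType) (s C C' : nat)
    (w : F -> nat) (w' : {unit F} -> nat) :
  (#|F| <= s ^ 2)%N ->
  wiener C%:R (fun x => (w x)%:R) -> wiener C'%:R (fun x => (w' x)%:R) ->
  (#|F| * \sum_(x : {unit F}) w (val x) * w' x <=
    (\sum_x w x) * (\sum_x w' x) + #|F| * s * (C * C'))%N.
Proof.
move=> qs wC wC'; have := wiener_decorrelation qs wC wC'.
move/(le_trans (real_ler_norm _)); rewrite lerBlDr => /(_ _) h.
rewrite -(ler_nat algC) natrD !natrM !natr_sum addrC.
under eq_bigr do rewrite natrM.
move: h; rewrite !natrM; apply.
rewrite realB ?realM ?ger0_real ?mulr_ge0 ?sumr_ge0 ?ler0n //;
  by move=> x _; rewrite ?mulr_ge0 ?ler0n.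
Qed.

(** [fattening] is applied in the additive and in the multiplicative group. Both weights are close
    to 1 on average over [A], so their product sums to almost [#|A|]; decorrelation bounds that sum
    through the total weights, which are about [#|P|] and [#|Q|] at most. *)
Lemma sum_product_fattening (R : realFieldType) (d1 d2 eps : R) (k1 k2 s : nat)
    (F : finFieldType) (A : {set {unit F}}) (D : {set F}) (E : {set {unit F}}) :
  (#|F| <= s ^ 2)%N -> (0 < #|A|)%N ->
  (forall x y, x \in A -> y \in A -> val x + val y \in D) ->
  (forall x y, x \in A -> y \in A -> (x * y)%g \in E) ->
  0 <= d1 <= 1 -> 0 <= d2 <= 1 -> (1 - d1) ^+ k1 <= eps -> (1 - d2) ^+ k2 <= eps ->
  let q : R := #|F|%:R in
  exists (P : {set F}) (Q : {set {unit F}}),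
  [/\ (1 - 2 * (k2%:R * d1)) * #|A|%:R * q <=
        (#|P|%:R + eps * q) * (#|Q|%:R + eps * q)
        + q * s%:R * (q / #|A|%:R) ^+ (2 * (k1 + k2)),
      forall y, y \in P -> #|[set x in P | y + x \notin D]|%:R <= d2 * q
    & forall y, y \in Q -> #|[set x in Q | (y * x)%g \notin E]|%:R <= d2 * q].
Proof.
move=> qs A0 AD AE d1E d2E k1E k2E q; pose K := (k1 + k2)%N.
have A'card : #|[set val x | x in A]| = #|A| by apply: card_imset val_inj.
have [|||P [w [W [wW [AW wleW] wA wP badP]]]] :=
  @fattening R d1 d2 eps k1 k2 F [set val x | x in A] D _ _ _ d1E d2E k1E k2E.
- by apply/centsP => x _ y _; rewrite /commute !FinRing.zmodMgE addrC.
- by rewrite A'card.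
- by move=> _ _ /imsetP[x Ax ->] /imsetP[y Ay ->]; apply: AD.
have [|//|//|Q [w' [W' [w'W' [AW' w'leW'] w'A w'Q badQ]]]] :=
  @fattening R d1 d2 eps k1 k2 {unit F} A E _ _ _ d1E d2E k1E k2E.
  apply/centsP => x _ y _; apply: val_inj.
  by rewrite /= mulrC.
have leuF := card_unit_le F.
have nq : #|{: {unit F}}|%:R <= q by rewrite ler_nat.
exists P, Q; split=> // [|y Qy]; last first.
  apply: le_trans (badQ y Qy) _; rewrite ler_wpM2l //; by case/andP: d2E.
have W0 : 0 < W%:R :> R.
  by rewrite ltr0n; apply: leq_trans AW; rewrite expn_gt0 A'card A0.
have W'0 : 0 < W'%:R :> R.
  by rewrite ltr0n; apply: leq_trans AW'; rewrite expn_gt0 A0.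
pose rho x : R := (w x)%:R / W%:R; pose rho' x : R := (w' x)%:R / W'%:R.
have rho1 x : 0 <= rho x <= 1.
  by rewrite divr_ge0 ?ler0n //= ler_pdivrMr // mul1r ler_nat.
have rho'1 x : 0 <= rho' x <= 1.
  by rewrite divr_ge0 ?ler0n //= ler_pdivrMr // mul1r ler_nat.
have lower : (1 - 2 * (k2%:R * d1)) * #|A|%:R <=
    \sum_(x : {unit F}) rho (val x) * rho' x.
  (* For [a], [b] at most 1, [a * b >= 1 - (1 - a) - (1 - b)]. *)
  apply: (@le_trans _ _ (\sum_(x in A) (1 - (1 - rho (val x)) - (1 - rho' x)))).
    move: wA; rewrite big_imset /=; last by move=> x y _ _; apply: val_inj.
    rewrite A'card => wA; rewrite sumrB sumrB sumr_const.
    by move: wA w'A; rewrite /rho /rho'; lra.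
  rewrite [leRHS](bigID (mem A)) /= -[leLHS]addr0; apply: lerD; last first.
    apply: sumr_ge0 => x _; case/andP: (rho1 (val x)) => rho0 _.
    by case/andP: (rho'1 x) => rho'0 _; rewrite mulr_ge0.
  apply: ler_sum => x _; have /andP[a0 a1] := rho1 (val x); have /andP[b0 b1] := rho'1 x.
  have : 0 <= (1 - rho (val x)) * (1 - rho' x) by rewrite mulr_ge0 ?subr_ge0.
  lra.
have decorr : q * (\sum_(x : {unit F}) rho (val x) * rho' x) <=
    (\sum_x rho x) * (\sum_x rho' x) + q * s%:R * (q / #|A|%:R) ^+ (2 * K).
  have := wiener_decorrelation_nat qs wW w'W'.
  rewrite -(ler_nat R) natrD !natrM !natr_sum => h.
  have -> : \sum_(x : {unit F}) rho (val x) * rho' x =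
      (\sum_(x : {unit F}) (w (val x) * w' x)%:R) / (W%:R * W'%:R).
    rewrite mulr_suml; apply: eq_bigr => x _.
    by rewrite natrM invfM mulrACA.
  rewrite -mulr_suml -mulr_suml mulrACA -invfM.
  have WW0 : 0 < W%:R * W'%:R :> R by rewrite mulr_gt0.
  rewrite mulrA ler_pdivrMr // mulrDl mulfVK ?gt_eqF //.
  apply: le_trans h _; rewrite lerD2l -!mulrA ler_wpM2l ?ler0n // ler_wpM2l ?ler0n //.
  rewrite -natrM -natrM.
  have a0 : 0 < #|A|%:R :> R by rewrite ltr0n.
  (* Each Wiener constant is the [K]-th power of a group order at most [q]; normalising divides by
     [W * W'], at least [#|A| ^ (2 * K)]. *)
  apply: (@le_trans _ _ (q ^+ (2 * K))).
    rewrite -natrX ler_nat. rewrite mul2n -addnn (expnD _ K) -/K leq_mul //.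
    by case: (K) => // k; rewrite leq_exp2r.
  rewrite expr_div_n -mulrA ler_peMr ?exprn_ge0 ?ler0n // mulrC ler_pdivlMr ?exprn_gt0 //.
  by rewrite mul1r -natrX ler_nat mul2n -addnn (expnD _ K) leq_mul // -A'card.
apply: le_trans (_ : q * (\sum_(x : {unit F}) rho (val x) * rho' x) <= _).
  by rewrite mulrC ler_wpM2l ?ler0n.
apply: le_trans decorr _; rewrite lerD2r ler_pM //.
- by apply: sumr_ge0 => x _; case/andP: (rho1 x).
- by apply: sumr_ge0 => x _; case/andP: (rho'1 x).
apply: le_trans w'Q _; rewrite lerD2l ler_wpM2l //.
by apply: le_trans k1E; rewrite exprn_ge0 // subr_ge0; case/andP: d1E.
Qed.

(** By induction, [(1 - d) ^+ k <= 1 / (1 + k%:R * d)]. *)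
Lemma exprn_small (R : archiRealFieldType) (d eta : R) :
  0 < d <= 1 -> 0 < eta -> exists k : nat, (1 - d) ^+ k <= eta.
Proof.
move=> /andP[d0 d1] eta0; have h k : (1 + k%:R * d) * (1 - d) ^+ k <= 1.
  elim: k => [|k]; first by rewrite mul0r addr0 expr0 mulr1.
  apply: le_trans; rewrite exprS mulrA ler_wpM2r ?exprn_ge0 ?subr_ge0 //.
  rewrite -natr1; have : 0 <= k%:R * (d * d) + d * d by rewrite addr_ge0 ?mulr_ge0 ?ler0n ?ltW.
  lra.
exists (Num.trunc (d * eta)^-1).+1; set k := _.+1.
have := truncnS_gt (d * eta)^-1; rewrite -/k.
rewrite -[_^-1]mul1r ltr_pdivrMr ?mulr_gt0 // => ke.
have x0 : 0 <= (1 - d) ^+ k by rewrite exprn_ge0 ?subr_ge0.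
have k0 : 0 < 1 + k%:R * d by rewrite ltr_wpDr ?mulr_ge0 ?ler0n ?ltW.
rewrite -(ler_pM2l k0); apply: le_trans (h k) _.
by rewrite mulrDl mul1r; nra.
Qed.

(** [q %/ B] bounds the square root of [q] and is still at most [q / B], so it can serve as [s]
    while keeping the decorrelation error small. *)
Lemma sqrt_upper_bound (q B : nat) : (0 < B)%N -> (4 * B ^ 2 <= q)%N ->
  (q <= (q %/ B) ^ 2)%N /\ ((q %/ B) * B <= q)%N.
Proof.
move=> B0 Bq; split; last exact: leq_divM.
have := ltn_ceil q B0; set s := (q %/ B)%N => qs.
have s1 : (B <= q)%N by nia.
have s0 : (1 <= s)%N by rewrite divn_gt0.
have qs2 : (q <= 2 * s * B)%N by nia.
have : (q * q <= s ^ 2 * q)%N.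
  apply: (@leq_trans (s ^ 2 * (4 * B ^ 2))%N); last by rewrite leq_mul2l Bq orbT.
  by have := leq_mul qs2 qs2; congr (_ <= _)%N; ring.
by rewrite leq_pmul2r //; nia.
Qed.

Lemma sum_product_structure (R : archiRealFieldType) (alpha0 d eps : R) :
  0 < alpha0 -> 0 < d <= 1 -> 0 < eps ->
  exists q0 : nat, forall (F : finFieldType) (A : {set {unit F}}) (D : {set F})
      (E : {set {unit F}}), let q : R := #|F|%:R in
    (q0 <= #|F|)%N -> alpha0 * q <= #|A|%:R ->
    (forall x y, x \in A -> y \in A -> val x + val y \in D) ->
    (forall x y, x \in A -> y \in A -> (x * y)%g \in E) ->
    exists (P : {set F}) (Q : {set {unit F}}),
    [/\ #|A|%:R / q - eps <= (#|P|%:R / q) * (#|Q|%:R / q),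
        forall y, y \in P -> #|[set x in P | y + x \notin D]|%:R <= d * q
      & forall y, y \in Q -> #|[set x in Q | (y * x)%g \notin E]|%:R <= d * q].
Proof.
(* Six errors of size at most [eta] are collected at the end. *)
move=> alpha0_gt0 d01 eps0; pose eta := Num.min 1 (eps / 8).
have eta0 : 0 < eta by rewrite lt_min ltr01 divr_gt0.
have eta1 : eta <= 1 by rewrite ge_min lexx.
have eta_eps : eta <= eps / 8 by rewrite ge_min lexx orbT.
(* The order matters: [k2] depends on [d], then [d1] is small in terms of [k2], then [k1] depends on
   [d1]. *)
have [k2 k2E] := exprn_small d01 eta0.
pose d1 := eta / (1 + k2%:R).
have k21 : 0 < 1 + k2%:R :> R by rewrite ltr_wpDr.
have d101 : 0 < d1 <= 1.
  rewrite divr_gt0 //= ler_pdivrMr // mul1r; apply: le_trans eta1 _.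
  by rewrite lerDl.
have k2d1 : k2%:R * d1 <= eta.
  by rewrite mulrA ler_pdivrMr // mulrC ler_wpM2l ?(ltW eta0) // lerDr.
have [k1 k1E] := exprn_small d101 eta0.
(* [B] absorbs the power of [q / #|A|], which is at most that of [alpha0^-1]. *)
pose M := (alpha0^-1 ^+ (2 * (k1 + k2))) / eta.
pose B := (Num.trunc M).+1.
have MB : M <= B%:R by apply/ltW/truncnS_gt.
exists (4 * B ^ 2)%N => F A D E q qB Aq AD AE.
have q0 : 0 < q by rewrite ltr0n; apply: leq_trans qB; rewrite muln_gt0 expn_gt0.
have a0 : 0 < #|A|%:R :> R by apply: lt_le_trans Aq; rewrite mulr_gt0.
have [qs sB] := sqrt_upper_bound (isT : 0 < B)%N qB.
set s := (#|F| %/ B)%N in qs sB.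
have A0 : (0 < #|A|)%N by rewrite -(ltr0n R).
have [P [Q [PQ badP badQ]]] := @sum_product_fattening R d1 d eta k1 k2 s F A D E
  qs A0 AD AE (ltac:(lra) : 0 <= d1 <= 1) (ltac:(lra) : 0 <= d <= 1) k1E k2E.
exists P, Q; split=> //.
rewrite -/q in PQ.
set a := #|P|%:R / q; set b := #|Q|%:R / q.
have PE : #|P|%:R = a * q by rewrite divfK ?gt_eqF.
have QE : #|Q|%:R = b * q by rewrite divfK ?gt_eqF.
have AE' : #|A|%:R = #|A|%:R / q * q by rewrite divfK ?gt_eqF.
have a01 : 0 <= a <= 1.
  by rewrite divr_ge0 ?ler0n //= ler_pdivrMr // mul1r ler_nat max_card.
have b01 : 0 <= b <= 1.
  rewrite divr_ge0 ?ler0n //= ler_pdivrMr // mul1r ler_nat.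
  exact: leq_trans (max_card _) (card_unit_le F).
have c01 : 0 <= #|A|%:R / q <= 1.
  rewrite divr_ge0 ?ler0n //= ler_pdivrMr // mul1r ler_nat.
  exact: leq_trans (max_card _) (card_unit_le F).
have err : s%:R * (q / #|A|%:R) ^+ (2 * (k1 + k2)) <= eta * q.
  apply: (@le_trans _ _ (s%:R * (alpha0^-1 ^+ (2 * (k1 + k2))))).
    rewrite ler_wpM2l ?ler0n // lerXn2r //.
    - by rewrite nnegrE divr_ge0 ?ler0n.
    - by rewrite nnegrE invr_ge0 ltW.
    by rewrite ler_pdivrMr // ler_pdivlMl.
  have -> : alpha0^-1 ^+ (2 * (k1 + k2)) = M * eta by rewrite divfK ?gt_eqF.
  rewrite mulrA mulrC ler_pM2l //.
  apply: (@le_trans _ _ (s%:R * B%:R)); first by rewrite ler_wpM2l ?ler0n.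
  by rewrite -natrM ler_nat.
move: PQ; rewrite PE QE {1}AE'; set c := #|A|%:R / q in c01 *.
rewrite -mulrDl -mulrDl -mulrA => PQ.
have {}PQ : (1 - 2 * (k2%:R * d1)) * c <= (a + eta) * (b + eta) + eta.
  have qq : 0 < q * q by rewrite mulr_gt0.
  rewrite -(ler_pM2r qq).
  apply: (@le_trans _ _ ((a + eta) * q * ((b + eta) * q) + q * (eta * q))).
    rewrite -[leLHS]mulrA [c * (q * q)]mulrA; apply: le_trans PQ _.
    by rewrite lerD2l -[leLHS]mulrA ler_wpM2l ?(ltW q0).
  by rewrite le_eqVlt; apply/orP; left; apply/eqP; ring.
move: a01 b01 c01 => /andP[a0' a1] /andP[b0' b1] /andP[c0 c1].
have : eta * a <= eta by rewrite ler_piMr // ltW.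
have : eta * b <= eta by rewrite ler_piMr // ltW.
have : eta * eta <= eta by rewrite ler_piMr // ltW.
have : (k2%:R * d1) * c <= eta.
  apply: le_trans k2d1; rewrite ler_piMr // mulr_ge0 //; lra.
by move: PQ; rewrite mulrBl mul1r mulrDl !mulrDr; lra.
Qed.

(** * Pollard's theorem *)

(** The convolution of the indicator functions of [A] and [B]. *)
Definition sum_reps (V : finZmodType) (A B : {set V}) (x : V) : nat :=
  (\sum_a (a \in A) * ((x - a)%R \in B))%N.

Lemma sum_repsC (V : finZmodType) (A B : {set V}) x :
  sum_reps A B x = sum_reps B A x.
Proof.
rewrite /sum_reps (reindex_inj (inv_inj (subKr x))).
by apply: eq_bigr => a _; rewrite subKr mulnC.
Qed.

Lemma sum_reps_leql (V : finZmodType) (A B : {set V}) x :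
  (sum_reps A B x <= #|A|)%N.
Proof.
rewrite -sum1_card big_mkcond; apply: leq_sum => a _.
by case: (a \in A); case: (_ \in B).
Qed.

Lemma sum_sum_reps (V : finZmodType) (A B : {set V}) :
  (\sum_x sum_reps A B x = #|A| * #|B|)%N.
Proof.
rewrite exchange_big /= -sum_nat_const [RHS]big_mkcond; apply: eq_bigr => a _.
rewrite -big_distrr /= (reindex_inj (addIr a)) /=.
under eq_bigr do rewrite addrK.
rewrite -[#|B|]sum1_card [in RHS]big_mkcond /=.
by case: (a \in A); rewrite ?mul1n ?mul0n.
Qed.

Lemma sum_reps_translate (V : finZmodType) (A B : {set V}) e x :
  sum_reps A [set b + e | b in B] (x + e) = sum_reps A B x.
Proof.
apply: eq_bigr => a _; congr (_ * nat_of_bool _)%N.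
by rewrite addrAC (mem_imset B (x - a) (addIr e)).
Qed.

(** Dyson's e-transform for convolutions: split [A] and [B] into their intersection and differences,
    expand, and regroup. *)
Lemma sum_reps_etransform (V : finZmodType) (A B : {set V}) x :
  sum_reps A B x =
    (sum_reps (A :|: B) (A :&: B) x + sum_reps (A :\: B) (B :\: A) x)%N.
Proof.
have swap (X Y : {set V}) :
    (\sum_a (a \in X) * ((x - a)%R \in Y) = \sum_a ((x - a)%R \in X) * (a \in Y))%N.
  by rewrite -/(sum_reps X Y x) sum_repsC; apply: eq_bigr => a _; rewrite mulnC.
have E : sum_reps (A :|: B) (A :&: B) x =
   (sum_reps A (A :&: B) x + sum_reps (A :&: B) (B :\: A) x)%N.
  rewrite [X in (_ + X)%N]sum_repsC -big_split; apply: eq_bigr => a _ /=.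
  by rewrite !inE; case: (a \in A); case: (a \in B); rewrite /= ?mul1n ?mul0n ?addn0.
rewrite E -addnA /sum_reps -!big_split; apply: eq_bigr => a _ /=.
rewrite !inE; case: (a \in A); case: (a \in B); case: (_ \in A); case: (_ \in B);
  by rewrite /= ?mul1n ?mul0n ?addn0.
Qed.

(** A proper nonempty [A] is not stable under the nonzero step [b1 - b0], which generates ['F_p];
    translating [b0] to a point where the step leaves [A] moves [b1] outside. *)
Lemma exists_proper_translate (p : nat) (A B : {set 'F_p}) :
  prime p -> (1 < #|B|)%N -> (0 < #|A| < p)%N ->
  exists e : 'F_p, let B' : {set 'F_p} := [set b + e | b in B] in
    (0 < #|A :&: B'|)%N /\ (0 < #|B' :\: A|)%N.
Proof.
move=> p_pr B1 /andP[A0 Ap].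
have [b0 [b1 [Bb0 Bb1 b01]]] : exists b0 b1, [/\ b0 \in B, b1 \in B & b0 != b1].
  by case/card_gt1P: B1 => b0 [b1 [? ? ?]]; exists b0, b1.
have [a /andP[Aa Ab]] : exists a, (a \in A) && (a + (b1 - b0) \notin A).
  apply/existsP; apply: contraLR Ap => /existsPn h; rewrite -leqNgt.
  rewrite -{1}(card_Fp p_pr); have [a Aa] := card_gt0P A0.
  have An n : a + (b1 - b0) *+ n \in A.
    elim: n => [|n IHn]; first by rewrite mulr0n addr0.
    by have := h (a + (b1 - b0) *+ n); rewrite IHn /= negbK mulrSr [in X in _ -> X]addrA.
  apply: subset_leq_card; apply/subsetP => x _.
  have d0 : b1 - b0 != 0 by rewrite subr_eq0 eq_sym.
  have := An (val ((x - a) / (b1 - b0))).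
  by rewrite -mulr_natr natr_Zp mulrC divfK // addrC subrK.
exists (a - b0) => B'.
split; apply/card_gt0P.
- by exists a; rewrite inE Aa; apply/imsetP; exists b0 => //; rewrite addrC subrK.
- exists (a + (b1 - b0)); rewrite inE Ab; apply/imsetP; exists b1 => //.
  by rewrite addrCA.
Qed.

(** Induction on [#|B|]: when a translate of [B] meets [A] without lying inside it, both second sets
    of the e-transform are smaller than [B]. *)
Theorem pollard (p : nat) (A B : {set 'F_p}) (t : nat) :
  prime p -> (t <= #|A|)%N -> (t <= #|B|)%N ->
  (t * minn p (#|A| + #|B| - t) <= \sum_x minn t (sum_reps A B x))%N.
Proof.
move=> p_pr; have [n] := ubnP #|B|; elim: n => // n IHn in A B t *.
rewrite ltnS => Bn tA tB; have Ap : (#|A| <= p)%N.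
  by rewrite -[leqRHS](card_Fp p_pr) max_card.
(* If the sets are too large, [B] is shrunk until [#|A| + #|B| = p + t]; the minimum with [p] does
   not change. *)
have [big|small] := ltnP (p + t) (#|A| + #|B|).
  have [B' B'B cB'] : exists2 B' : {set 'F_p}, B' \subset B & #|B'| = (p + t - #|A|)%N.
    have /card_geqP[s [s_uniq s_size sB]] : (p + t - #|A| <= #|B|)%N by lia.
    exists [set x in s]; first by apply/subsetP => x; rewrite inE => /sB.
    by rewrite cardsE (card_uniqP s_uniq).
  apply: leq_trans (_ : t * minn p (#|A| + #|B'| - t) <= _)%N.
    by rewrite leq_mul2l; apply/orP; right; lia.
  apply: leq_trans (IHn A B' t _ tA _) _; rewrite ?cB'; try lia.
  apply: leq_sum => x _; rewrite leq_min geq_minl /=; apply: leq_trans (geq_minr _ _) _.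
  apply: leq_sum => a _; rewrite leq_mul2l; apply/orP; right.
  by case: (boolP (_ \in B')) => // /(subsetP B'B) ->.
have -> : minn p (#|A| + #|B| - t) = (#|A| + #|B| - t)%N by lia.
have [tB'|tltB] := eqVneq t #|B|.
  rewrite (eq_bigr (sum_reps A B)) => [|x _].
    by rewrite sum_sum_reps tB' mulnC addnK.
  by apply/minn_idPr; rewrite sum_repsC tB' sum_reps_leql.
have [->|t0] := posnP t; first by rewrite mul0n.
have [||e] := @exists_proper_translate p A B p_pr; try lia.
set B' : {set 'F_p} := [set b + e | b in B] => -[I0 BA0].
have cB' : #|B'| = #|B| by apply: card_imset (addIr e).
have -> : (\sum_x minn t (sum_reps A B x) = \sum_x minn t (sum_reps A B' x))%N.
  rewrite [RHS](reindex_inj (addIr e)); apply: eq_bigr => x _.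
  by rewrite sum_reps_translate.
have cU := cardsUI A B'; have cA := cardsID B' A; have cBA := cardsID A B'.
rewrite setIC in cBA.
have [tI|It] := leqP t #|A :&: B'|.
  have := IHn (A :|: B') (A :&: B') t; rewrite cU cB'.
  have -> : minn p (#|A| + #|B| - t) = (#|A| + #|B| - t)%N by lia.
  move=> IH; apply: leq_trans (IH _ _ _) _; try lia.
  apply: leq_sum => x _; rewrite leq_min geq_minl /=; apply: leq_trans (geq_minr _ _) _.
  by rewrite [leqRHS]sum_reps_etransform leq_addr.
(* Here the first convolution, at most [#|A :&: B'| < t], counts in full, and the rest of the cap
   goes to the differences. *)
have split_min x : (sum_reps (A :|: B') (A :&: B') x +
    minn (t - #|A :&: B'|) (sum_reps (A :\: B') (B' :\: A) x) <=
    minn t (sum_reps A B' x))%N.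
  rewrite (sum_reps_etransform A B' x).
  have := sum_reps_leql (A :&: B') (A :|: B') x; rewrite sum_repsC.
  move: (sum_reps (A :|: B') _ x) (sum_reps (A :\: B') _ x) #|A :&: B'| It => u v i.
  lia.
apply: leq_trans (leq_sum _ (fun x _ => split_min x)); rewrite big_split /=.
rewrite sum_sum_reps.
have IH := IHn (A :\: B') (B' :\: A) (t - #|A :&: B'|)%N.
apply: leq_trans (leq_add (leqnn _) (IH _ _ _)); try lia.
move: cU cA cBA; rewrite cB'; set i := #|A :&: B'| in It I0 *.
set u := #|A :|: B'|; 
set x := #|A :\: B'|; set y := #|B' :\: A|; clear IH.
move=> cU cA cBA.
have -> : minn p (x + y - (t - i)) = (x + y - (t - i))%N by lia.
(* With these names the claim is the identity [(i + j) * (i + z) = (i + j + z) * i + j * z]. *)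
have [j tE] : exists j, t = (i + j)%N by exists (t - i)%N; lia.
have [z zE] : exists z, (x + y = j + z)%N by exists (x + y - j)%N; lia.
have -> : (t - i = j)%N by lia.
have -> : (x + y - j = z)%N by lia.
have -> : u = (i + j + z)%N by lia.
have -> : (#|A| + #|B| - t = i + z)%N by lia.
rewrite tE; nia.
Qed.

(** In Pollard's sum each element of [D] counts at most [t]; those outside [D] count at most the
    exceptional pairs, of which there are at most [b * #|P|]. *)
Lemma popular_sumset (p t b : nat) (P D : {set 'F_p}) :
  prime p -> (t <= #|P|)%N ->
  (forall y, y \in P -> #|[set x in P | (y + x)%R \notin D]| <= b)%N ->
  (t * minn p (2 * #|P| - t) <= t * #|D| + b * #|P|)%N.
Proof.
move=> p_pr tP badP; rewrite mul2n -addnn; apply: leq_trans (pollard p_pr tP tP) _.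
rewrite (bigID (mem D)) /=; apply: leq_add.
  rewrite mulnC -sum_nat_const; apply: leq_sum => x _; exact: geq_minl.
apply: (@leq_trans (\sum_(x | x \notin D) sum_reps P P x)%N).
  by apply: leq_sum => x _; apply: geq_minr.
rewrite exchange_big /= [leqRHS]mulnC -sum_nat_const [leqRHS]big_mkcond.
apply: leq_sum => y _; rewrite -big_distrr /=.
have [Py|_] := boolP (y \in P); last by rewrite mul0n.
rewrite mul1n; apply: leq_trans (badP y Py).
rewrite (reindex_inj (addrI y)) /= -sum1_card [leqLHS]big_mkcond [leqRHS]big_mkcond.
apply: leq_sum => x _; rewrite inE [y + x - y]addrC addKr.
by case: (_ \in D); case: (x \in P).
Qed.

(** * A robust form of Freiman's 3/2 theorem *)

Lemma correlation_total (gT : finGroupType) (X Y : {set gT}) :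
  (\sum_x correlation X Y x = #|X| * #|Y|)%N.
Proof.
have E x : correlation X Y x = (\sum_(a in X) ((x * a)%g \in Y))%N.
  rewrite /correlation -sum1_card big_mkcond [RHS]big_mkcond.
  by apply: eq_bigr => a _; rewrite inE; case: (a \in X) => //=; case: ifP.
under eq_bigr do rewrite E.
rewrite exchange_big /= -sum_nat_const; apply: eq_bigr => a _.
rewrite (reindex_inj (mulIg a^-1%g)) -sum1_card [in RHS]big_mkcond /=.
by apply: eq_bigr => x _; rewrite mulgKV; case: ifP.
Qed.

Lemma card_inter_ge (T : finType) (A B C : {set T}) :
  A \subset C -> B \subset C -> (#|A| + #|B| <= #|A :&: B| + #|C|)%N.
Proof.
move=> AC BC; rewrite -cardsUI addnC leq_add2l subset_leq_card //.
by rewrite subUset AC.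
Qed.

(** For [z] in the coset of [x * x], both [Q] and [z Q^-1] lie in [x H], so they share [m] elements
    and [z] has [m] representations; the elements outside [E] have at most [b * #|Q|] in all. *)
Lemma popular_prodset_coset (gT : finGroupType) (H : {group gT}) (x : gT)
    (Q E : {set gT}) (m b : nat) :
  abelian [set: gT] -> Q \subset (x *: H)%g -> (#|H| + m <= 2 * #|Q|)%N ->
  (forall y, y \in Q -> #|[set z in Q | (y * z)%g \notin E]| <= b)%N ->
  (m * #|H| <= m * #|E| + b * #|Q|)%N.
Proof.
move=> abG QH Hm badQ; have comm (y z : gT) : (y * z = z * y)%g.
  by apply: (centsP abG); rewrite inE.
pose reps z := (\sum_a (a \in Q) * ((a^-1 * z)%g \in Q))%N.
have many z : z \in ((x * x) *: H)%g -> (m <= reps z)%N.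
  case/lcosetP=> h Hh ->{z}; set z := (x * x * h)%g.
  pose Q' := [set (z * a^-1)%g | a in Q].
  have cQ' : #|Q'| = #|Q|.
    by apply: card_imset => a c /mulgI /invg_inj.
  have Q'H : Q' \subset (x *: H)%g.
    apply/subsetP => _ /imsetP[a /(subsetP QH)/lcosetP[h' Hh' ->] ->].
    rewrite mem_lcoset /z invMg !mulgA mulVg mul1g (comm _ x^-1%g) -!mulgA mulKg.
    by rewrite groupM ?groupV.
  have := card_inter_ge QH Q'H; rewrite cQ' card_lcoset => le1.
  have -> : reps z = #|Q :&: Q'|.
    rewrite -sum1_card [RHS]big_mkcond; apply: eq_bigr => a _ /=; rewrite inE.
    have -> : (a \in Q') = ((a^-1 * z)%g \in Q).
      apply/imsetP/idP => [[c Qc ->]|Qc].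
        by rewrite invMg invgK mulgKV.
      by exists (a^-1 * z)%g; rewrite // invMg invgK mulKVg.
    by case: (a \in Q); case: (_ \in Q).
  rewrite -(leq_add2l #|H|); apply: leq_trans Hm _.
  by rewrite mul2n -addnn [leqRHS]addnC.
have few : (\sum_(z | z \notin E) reps z <= b * #|Q|)%N.
  rewrite exchange_big /= mulnC -sum_nat_const [leqRHS]big_mkcond.
  apply: leq_sum => y _; rewrite -big_distrr /=.
  have [Qy|_] := boolP (y \in Q); last by rewrite mul0n.
  rewrite mul1n; apply: leq_trans (badQ y Qy).
  rewrite (reindex_inj (mulgI y)) /= -sum1_card [leqLHS]big_mkcond [leqRHS]big_mkcond.
  apply: leq_sum => z _; rewrite inE mulKg.
  by case: (_ \in E); case: (z \in Q).
rewrite -(card_lcoset H (x * x)) -(cardsID E (_ *: _)%g) mulnDr leq_add //.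
  by rewrite leq_mul2l subset_leq_card ?orbT ?subsetIr.
apply: leq_trans few; rewrite mulnC -sum_nat_const big_mkcond [leqRHS]big_mkcond.
by apply: leq_sum => z _; rewrite inE; case: (_ \notin E) => //=; case: ifP => // /many.
Qed.

(* Freiman's 3/2 argument: any two translates of [Q] share more than half of
   their elements, so the set of quotients is closed under multiplication. *)
Lemma quotient_set_group (gT : finGroupType) (Q E : {set gT}) (m b : nat) :
  abelian [set: gT] -> (0 < #|Q|)%N -> (0 < m)%N ->
  (2 * #|E| + 4 * b + m <= 3 * #|Q|)%N ->
  (forall y, y \in Q -> #|[set z in Q | (y * z)%g \notin E]| <= b)%N ->
  exists H : {group gT}, (forall x, x \in Q -> Q \subset (x *: H)%g) /\
    (#|H| * (#|Q| + m) <= 2 * #|Q| ^ 2)%N.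
Proof.
move=> abG Q0 m0 Em badQ; have comm (y z : gT) : (y * z = z * y)%g.
  by apply: (centsP abG); rewrite inE.
pose K := [set (x * y^-1)%g | x in Q, y in Q].
have half g : g \in K -> (#|Q| + m <= 2 * correlation Q Q g)%N.
  case/imset2P=> x y Qx Qy ->.
  (* Up to [b] elements each, [x Q] and [y Q] lie in the small set [E], which forces them to
     overlap. *)
  pose G y := [set (y * z)%g | z in [set z in Q | (y * z)%g \in E]].
  have cG y' : y' \in Q -> (#|Q| <= #|G y'| + b)%N.
    move=> Qy'; rewrite card_imset; last exact: mulgI.
    rewrite -(cardsID [set z | (y' * z)%g \in E] Q) leq_add //.
      by apply: subset_leq_card; apply/subsetP => z; rewrite !inE.
    apply: leq_trans (badQ _ Qy'); apply: subset_leq_card.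
    by apply/subsetP => z; rewrite !inE andbC.
  have GE y' : G y' \subset E.
    by apply/subsetP => _ /imsetP[z + ->]; rewrite inE => /andP[].
  have arith (i c gx gy e q : nat) : (q <= gx + b -> q <= gy + b ->
      gx + gy <= i + e -> 2 * e + 4 * b + m <= 3 * q -> i <= c -> q + m <= 2 * c)%N.
    by lia.
  apply: (arith _ _ _ _ _ _ (cG x Qx) (cG y Qy) (card_inter_ge (GE x) (GE y)) Em).
  rewrite -(card_imset _ (mulgI x^-1%g)); apply: subset_leq_card.
  apply/subsetP => _ /imsetP[u /setIP[/imsetP[z + ->] /imsetP[z' + zE]] ->].
  rewrite !inE => /andP[Qz _] /andP[Qz' _]; rewrite mulKg Qz /=.
  by rewrite (comm x) -mulgA zE mulKg.
have KV g : g \in K -> g^-1%g \in K.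
  case/imset2P=> x y Qx Qy ->; rewrite invMg invgK.
  exact: imset2_f.
have Kgroup : group_set K.
  apply/group_setP; split=> [|g h Kg Kh].
    have [x0 Qx0] : exists x0, x0 \in Q by apply/card_gt0P.
    by rewrite -(mulgV x0); apply: imset2_f.
  (* Two subsets of [Q], each larger than half of it, share some [u]; then [g * h] is the quotient
     of [g * u] by [h^-1 * u]. *)
  pose B g := [set u in Q | (g * u)%g \in Q].
  have BQ g' : B g' \subset Q by apply/subsetP => u; rewrite inE => /andP[].
  have := card_inter_ge (BQ g) (BQ h^-1%g).
  have := half _ Kg; have := half _ (KV _ Kh); rewrite /correlation -!/(B _).
  have arith (i a c q : nat) : (q + m <= 2 * c -> q + m <= 2 * a ->
      a + c <= i + q -> 0 < i)%N by lia.
  move=> h1 h2 /(arith _ _ _ _ h1 h2)/card_gt0P[u].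
  rewrite !inE => /andP[/andP[_ Q1] /andP[_ Q2]].
  have -> : (g * h = g * u * (h^-1 * u)^-1)%g by rewrite invMg invgK !mulgA mulgK.
  exact: imset2_f.
exists (Group Kgroup); split=> [x Qx|].
  apply/subsetP => y Qy; rewrite mem_lcoset /= comm.
  exact: imset2_f.
(* The correlations sum to [#|Q| ^ 2], and each element of [K] takes at least half of [#|Q| + m]. *)
rewrite -mulnn -(correlation_total Q Q) big_distrr /= -sum_nat_const big_mkcond.
by apply: leq_sum => g _; case: ifP => // /half.
Qed.

(* A robust form of the consequence [|Q| > |G|/(l+1) -> |QQ| >= |G|/l] of Kneser's
   theorem. *)
Lemma popular_prodset (gT : finGroupType) (Q E : {set gT}) (l m b : nat) :
  abelian [set: gT] -> (0 < l)%N -> (0 < m)%N -> (4 * b <= m)%N ->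
  (#|gT| + l.+1 * m <= l.+1 * #|Q|)%N ->
  (forall y, y \in Q -> #|[set z in Q | (y * z)%g \notin E]| <= b)%N ->
  (m * #|gT| <= l * (m * #|E| + b * #|Q|))%N.
Proof.
move=> abG l0 m0 bm QN badQ.
have [/eqP l1|l1] := boolP (l == 1)%N.
  have QT : Q \subset (1 *: [set: gT]%G)%g by rewrite lcoset1 subsetT.
  have : (#|[set: gT]%G| + 2 * m <= 2 * #|Q|)%N by rewrite cardsT; move: QN; rewrite l1.
  move/(popular_prodset_coset abG QT) => /(_ _ _ badQ).
  by rewrite cardsT l1 mul1n -!mulnA; move: #|gT| #|E| #|Q| => N e q; lia.
have [NE|EN] := leqP #|gT| (l * #|E|).
  have := leq_mul (leqnn m) NE; rewrite mulnDr; lia.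
have Q0 : (0 < #|Q|)%N by nia.
(* Now [#|E| < #|gT| / l] and [#|Q| >= #|gT| / (l + 1) + m]; as [2 / l <= 3 / (l + 1)] for [l >= 2],
   Freiman's argument applies. *)
have [||H [QH cH]] := quotient_set_group abG Q0 (_ : 0 < 2 * m)%N _ badQ; first by lia.
  have : (l * l.+1 * (2 * #|E| + 4 * b + 2 * m) <= l * l.+1 * (3 * #|Q|))%N by nia.
  by rewrite leq_pmul2l // muln_gt0 l0.
have [x Qx] := card_gt0P Q0.
have mQ : (m <= #|Q|)%N by nia.
have Hm : (#|H| + m <= 2 * #|Q|)%N by nia.
have QleH : (#|Q| <= #|H|)%N by rewrite -(card_lcoset H x) subset_leq_card ?QH.
have HN := LagrangeI [set: gT]%G H.
(* The index of [H] is an integer below [l + 1], because [#|H| >= #|Q| > #|gT| / (l + 1)]. *)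
have nl : (#|gT| <= l * #|H|)%N.
  have dvd : (#|H| %| #|gT|)%N by rewrite -cardsT cardSg // subsetT.
  case/dvdnP: dvd => n nE; rewrite nE leq_mul2r; apply/orP; right; nia.
have := popular_prodset_coset abG (QH x Qx) Hm badQ; nia.
Qed.

(** * The lower bound *)

Lemma card_Fp_le (p : nat) (A : {set 'F_p}) : prime p -> (#|A| <= p)%N.
Proof. by move=> p_pr; rewrite -[leqRHS](card_Fp p_pr) max_card. Qed.

Lemma trunc_ler (R : archiRealFieldType) (x : R) : 0 <= x ->
  ((Num.trunc x)%:R <= x) /\ (x < (Num.trunc x)%:R + 1).
Proof.
move=> x0; have /andP[h1 h2] := truncn_itv x0.
by split=> //; rewrite natr1.
Qed.

(** Take [t] about [tau * p]: subtracting [t] costs [tau], and [tau ^+ 2 * p] exceptions per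
    element, divided by [t >= tau * p / 2], cost [2 * tau]. *)
Lemma popular_sumset_density (R : archiRealFieldType) (tau : R) (p : nat)
    (P D : {set 'F_p}) :
  prime p -> 0 < tau -> 2 <= tau * p%:R -> tau * p%:R <= #|P|%:R ->
  (forall y, y \in P -> #|[set x in P | (y + x)%R \notin D]|%:R <= tau ^+ 2 * p%:R) ->
  Num.min 1 (2 * (#|P|%:R / p%:R)) - 3 * tau <= #|D|%:R / p%:R.
Proof.
move=> p_pr tau0 tp tP badP; have p0 : 0 < p%:R :> R by rewrite ltr0n prime_gt0.
have [t_le t_gt] := trunc_ler (ltW (mulr_gt0 tau0 p0)).
set t := Num.trunc _ in t_le t_gt.
have [b_le b_gt] := trunc_ler (ltW (mulr_gt0 (exprn_gt0 2 tau0) p0)).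
set b := Num.trunc _ in b_le b_gt.
have tP' : (t <= #|P|)%N by rewrite -(ler_nat R); apply: le_trans tP.
have bad y : y \in P -> (#|[set x in P | (y + x)%R \notin D]| <= b)%N.
  by move=> Py; rewrite truncn_ge_nat ?badP // mulr_ge0 ?exprn_ge0 ?ltW.
have := popular_sumset p_pr tP' bad.
rewrite -(ler_nat R) natrD !natrM.
have Pp : #|P|%:R <= p%:R :> R by rewrite ler_nat card_Fp_le.
have t2 : tau * p%:R / 2 <= t%:R by lra.
have t0 : 0 < t%:R :> R by lra.
have bP : b%:R * #|P|%:R <= t%:R * (2 * tau * p%:R).
  apply: (@le_trans _ _ (tau ^+ 2 * p%:R * p%:R)); first by rewrite ler_pM ?ler0n.
  apply: (@le_trans _ _ (tau * p%:R / 2 * (2 * tau * p%:R))).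
    by rewrite le_eqVlt; apply/orP; left; apply/eqP; field.
  by rewrite ler_pM2r // !mulr_gt0.
move=> h.
have {}h : (minn p (2 * #|P| - t))%:R <= #|D|%:R + 2 * tau * p%:R :> R.
  by rewrite -(ler_pM2l t0) mulrDr; apply: le_trans h _; rewrite lerD2l.
rewrite ler_pdivlMr // mulrBl; set a := #|P|%:R / p%:R.
have PE : #|P|%:R = a * p%:R by rewrite divfK ?gt_eqF.
have [le1|le2] := leqP p (2 * #|P| - t).
  rewrite (minn_idPl le1) in h.
  have : Num.min 1 (2 * a) * p%:R <= p%:R by rewrite ler_piMl ?ge_min ?lexx ?ler0n.
  have := mulr_gt0 tau0 p0; lra.
have t2P : (t <= 2 * #|P|)%N by apply: leq_trans tP' (leq_pmull _ _).
rewrite (minn_idPr (ltnW le2)) (natrB _ t2P) natrM in h.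
have : Num.min 1 (2 * a) * p%:R <= 2 * a * p%:R.
  by rewrite ler_wpM2r ?ler0n // ge_min lexx orbT.
rewrite PE in h; lra.
Qed.

(** Take [m] about [tau * p]: the exceptions cost [2 * tau], and the third [tau] pays for
    [#|gT| = p - 1]. *)
Lemma popular_prodset_density (R : archiRealFieldType) (tau : R)
    (gT : finGroupType) (p l : nat) (Q E : {set gT}) :
  abelian [set: gT] -> p = #|gT|.+1 -> (0 < l)%N ->
  0 < tau <= 4^-1 -> 2 <= tau * p%:R ->
  1 <= l.+1%:R * (#|Q|%:R / p%:R - tau) ->
  (forall y, y \in Q -> #|[set z in Q | (y * z)%g \notin E]|%:R <= tau ^+ 2 * p%:R) ->
  1 / l%:R - 3 * tau <= #|E|%:R / p%:R.
Proof.
move=> abG pE l0 /andP[tau0 tau4] tp lQ badQ.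
have p0 : 0 < p%:R :> R by rewrite pE ltr0n.
have [m_le m_gt] := trunc_ler (ltW (mulr_gt0 tau0 p0)).
set m := Num.trunc _ in m_le m_gt.
have [b_le b_gt] := trunc_ler (ltW (mulr_gt0 (exprn_gt0 2 tau0) p0)).
set b := Num.trunc _ in b_le b_gt.
have bad y : y \in Q -> (#|[set z in Q | (y * z)%g \notin E]| <= b)%N.
  by move=> Qy; rewrite truncn_ge_nat ?badQ // mulr_ge0 ?exprn_ge0 ?ltW.
have l0' : 0 < l%:R :> R by rewrite ltr0n.
have m2 : tau * p%:R / 2 <= m%:R by lra.
have m0' : 0 < m%:R :> R by lra.
have m0 : (0 < m)%N by rewrite -(ltr0n R).
have Np : #|gT|%:R = p%:R - 1 :> R by rewrite pE -natr1 addrK.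
have Qp : #|Q|%:R <= p%:R :> R.
  by rewrite ler_nat pE; apply: leq_trans (max_card _) _.
have bm : (4 * b <= m)%N.
  rewrite truncn_ge_nat ?(ltW (mulr_gt0 tau0 p0)) // natrM.
  have : 4 * tau * (tau * p%:R) <= tau * p%:R 
    by rewrite ler_piMl ?mulr_ge0 ?(ltW tau0) ?(ltW p0) //; lra.
  rewrite expr2 in b_le; lra.
have QN : (#|gT| + l.+1 * m <= l.+1 * #|Q|)%N.
  rewrite -(ler_nat R) natrD !natrM Np.
  have QE : #|Q|%:R / p%:R * p%:R = #|Q|%:R :> R by rewrite divfK ?gt_eqF.
  have : 1 * p%:R <= l.+1%:R * (#|Q|%:R / p%:R - tau) * p%:R by rewrite ler_pM2r.
  rewrite -mulrA mulrBl QE mulrBr => h.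
  have : l.+1%:R * m%:R <= l.+1%:R * (tau * p%:R) by rewrite ler_wpM2l ?ler0n.
  lra.
have := popular_prodset abG l0 m0 bm QN bad.
rewrite -(ler_nat R) !(natrM, natrD) Np => h.
have bQ : b%:R * #|Q|%:R <= m%:R * (2 * tau * p%:R).
  apply: (@le_trans _ _ (tau ^+ 2 * p%:R * p%:R)); first by rewrite ler_pM ?ler0n.
  apply: (@le_trans _ _ (tau * p%:R / 2 * (2 * tau * p%:R))).
    by rewrite le_eqVlt; apply/orP; left; apply/eqP; field.
  by rewrite ler_pM2r // !mulr_gt0.
have {}h : p%:R - 1 <= l%:R * (#|E|%:R + 2 * tau * p%:R).
  rewrite -(ler_pM2l m0'); apply: le_trans h _.
  by rewrite [leRHS]mulrCA ler_pM2l // mulrDr lerD2l.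
rewrite ler_pdivlMr // mulrBl.
have {}h : (p%:R - 1) / l%:R <= #|E|%:R + 2 * tau * p%:R.
  by rewrite ler_pdivrMr // mulrC.
have : l%:R^-1 <= 1 :> R by rewrite invf_le1 // ler1n.
move: h; rewrite mulrBl !mul1r; lra.
Qed.

Lemma sum_product_lower_bound (R : archiRealFieldType) (alpha eps : R) :
  0 < alpha <= 1 -> 0 < eps ->
  exists p0 : nat, forall p, prime p -> (p0 <= p)%N ->
  forall A : {set 'F_p}, alpha * p%:R <= #|A|%:R ->
  exists2 l : nat, (0 < l)%N &
    Num.min 1 (Num.max (2 * l%:R * alpha) (1 / l%:R)) - eps <=
      (maxn #|sumset A| #|prodset A|)%:R / p%:R.
Proof.
move=> /andP[alpha0 alpha1] eps0.
(* [alpha / 16] keeps [b - tau] above [alpha / 4], so that [l * alpha <= 4]; [eps * alpha / 48] then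
   gives [l * tau <= eps / 12]. *)
pose tau := Num.min (alpha / 16) (eps * alpha / 48).
have tau0 : 0 < tau by rewrite lt_min !divr_gt0 ?mulr_gt0.
have tau_alpha : tau <= alpha / 16 by rewrite ge_min lexx.
have tau_eps : tau <= eps * alpha / 48 by rewrite ge_min lexx orbT.
have eps_alpha : eps * alpha <= eps by rewrite ler_piMr ?(ltW eps0).
have a20 : 0 < alpha / 2 by rewrite divr_gt0.
have tau2 : 0 < tau ^+ 2 <= 1.
  by rewrite exprn_gt0 //= exprn_ile1 ?(ltW tau0) //; lra.
(* Density [alpha / 2] leaves room for removing 0 from [A]. *)
have [q0 structure] := sum_product_structure a20 tau2 tau0.
exists (maxn q0 (Num.trunc (2 / tau)).+1) => p p_pr.
rewrite geq_max => /andP[q0p tp] A Aalpha.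
have p0 : 0 < p%:R :> R by rewrite ltr0n prime_gt0.
have {}tp : 2 <= tau * p%:R.
  rewrite mulrC -ler_pdivrMr //; apply/ltW/(lt_le_trans (truncnS_gt _)).
  by rewrite ler_nat.
pose U : {set {unit 'F_p}} := [set u | val u \in A].
pose E : {set {unit 'F_p}} := [set u | val u \in prodset A].
have AU : (#|A| <= #|U|.+1)%N.
  have -> : (#|U|.+1 = #|[set (0%R : 'F_p)]| + #|[set val u | u in U]|)%N.
    by rewrite cards1 card_imset //; apply: val_inj.
  apply: leq_trans (leq_card_setU _ _); apply: subset_leq_card; apply/subsetP => x Ax.
  rewrite !inE; have [//|x0] := eqVneq x 0; apply/imsetP.
  by exists (FinRing.unit 'F_p (etrans (unitfE x) x0)); rewrite ?inE.
have AU' : #|A|%:R <= #|U|%:R + 1 :> R by rewrite natr1 ler_nat.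
have EA : (#|E| <= #|prodset A|)%N.
  rewrite -(card_imset E val_inj); apply: subset_leq_card.
  by apply/subsetP => _ /imsetP[u + ->]; rewrite inE.
have qE : #|'F_p|%:R = p%:R :> R by rewrite card_Fp.
have := structure 'F_p U (sumset A) E; rewrite qE card_Fp //.
case=> //.
- have : 8 * tau * p%:R <= alpha / 2 * p%:R by rewrite ler_wpM2r ?ler0n //; lra.
  lra.
- by move=> x y; rewrite !inE => Ax Ay; apply: imset2_f.
- by move=> x y; rewrite !inE => Ax Ay; apply: imset2_f.
move=> P [Q [PQ badP badQ]]; clear structure.
set a := #|P|%:R / p%:R in PQ; set b := #|Q|%:R / p%:R in PQ.
have unitp : p = #|{: {unit 'F_p}}|.+1.
  by rewrite -cardsT card_finField_unit card_Fp // prednK ?prime_gt0.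
have a01 : 0 <= a <= 1.
  by rewrite divr_ge0 ?ler0n //= ler_pdivrMr // mul1r ler_nat card_Fp_le.
have b01 : 0 <= b <= 1.
  rewrite divr_ge0 ?ler0n //= ler_pdivrMr // mul1r ler_nat [leqRHS]unitp.
  exact: leq_trans (max_card _) _.
move: a01 b01 => /andP[a0 a1] /andP[b0 b1].
have ab : alpha - 2 * tau <= a * b.
  apply: le_trans PQ; have : (alpha * p%:R - 1) / p%:R <= #|U|%:R / p%:R.
    by rewrite ler_pM2r ?invr_gt0 //; lra.
  rewrite mulrBl mulfK ?gt_eqF // mul1r.
  have : p%:R^-1 <= tau by rewrite -[p%:R^-1]mul1r ler_pdivrMr //; lra.
  lra.
have ab_a : a * b <= a by rewrite ler_piMr.
have ab_b : a * b <= b by rewrite ler_piMl.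
(* [l] is chosen so that [b - tau] lies between [1 / (l + 1)] and [1 / l]. *)
pose l := Num.trunc (b - tau)^-1.
have bt0 : 0 < b - tau by lra.
have bt0' : 0 < (b - tau)^-1 by rewrite invr_gt0.
have [l_le l_gt] := trunc_ler (ltW bt0'); rewrite -/l in l_le l_gt.
have l0 : (0 < l)%N.
  by rewrite truncn_gt0 invf_ge1 //; lra.
have l0' : 0 < l%:R :> R by rewrite ltr0n.
exists l => //.
have lb : l%:R * (b - tau) <= 1 by rewrite -ler_pdivlMr // div1r.
have lb' : 1 <= l.+1%:R * (b - tau).
  by rewrite -ler_pdivrMr // div1r -natr1 ltW.
have l_alpha : l%:R * alpha <= 4.
  have : l%:R * (alpha / 4) <= l%:R * (b - tau) by rewrite ler_pM2l //; lra.
  lra.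
have tau14 : 0 < tau <= 4^-1 by rewrite tau0 /=; lra.
have unit_ab : abelian [set: {unit 'F_p}].
  by apply/centsP => x _ y _; apply: val_inj; rewrite /= mulrC.
have EL := popular_prodset_density unit_ab unitp l0 tau14 tp lb' badQ.
have tP : tau * p%:R <= #|P|%:R by rewrite -ler_pdivlMr // -/a; lra.
have DL := popular_sumset_density p_pr tau0 tp tP badP.
rewrite -/a in DL.
have DM : #|sumset A|%:R / p%:R <= (maxn #|sumset A| #|prodset A|)%:R / p%:R :> R.
  by rewrite ler_pM2r ?invr_gt0 // ler_nat leq_maxl.
have EM : #|E|%:R / p%:R <= (maxn #|sumset A| #|prodset A|)%:R / p%:R :> R.
  by rewrite ler_pM2r ?invr_gt0 // ler_nat (leq_trans EA) ?leq_maxr.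
clear badP badQ AU AU' unit_ab tau14 lb'.
(* Multiply [a * b >= alpha - 2 * tau] by [l] and use [l * (b - tau) <= 1]. *)
have la : l%:R * alpha - 3 * (l%:R * tau) <= a.
  have : l%:R * (alpha - 2 * tau) <= l%:R * (a * b) by rewrite ler_pM2l.
  have : a * (l%:R * (b - tau)) <= a by rewrite ler_piMr.
  have : a * (l%:R * tau) <= l%:R * tau by rewrite ler_piMl // mulr_ge0 ?ltW.
  rewrite !mulrBr => h1 h2 h3.
  have E1 : a * (l%:R * b) = l%:R * (a * b) by ring.
  rewrite E1 in h2; lra.
have lt : l%:R * tau <= eps / 12.
  have : l%:R * tau <= l%:R * (eps * alpha / 48) by rewrite ler_pM2l.
  have : eps * (l%:R * alpha) <= eps * 4 by rewrite ler_pM2l.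
  have -> : l%:R * (eps * alpha / 48) = eps * (l%:R * alpha) / 48 by field.
  lra.
move: ((maxn _ _)%:R / _) DM EM => M DM EM.
have tau_eps' : tau <= eps / 48 by clear -tau_eps eps_alpha; lra.
clear -DL EL DM EM la lt tau_eps' tau0 eps0.
(* If [1 / l] is the maximum, the product set is large enough; otherwise the sumset is. *)
have [h|h] := leP (2 * l%:R * alpha) (1 / l%:R).
  have : Num.min 1 (1 / l%:R) <= 1 / l%:R :> R by rewrite ge_min lexx orbT.
  lra.
have : Num.min 1 (2 * l%:R * alpha) <= 2 * l%:R * alpha by rewrite ge_min lexx orbT.
have : Num.min 1 (2 * l%:R * alpha) <= 1 by rewrite ge_min lexx.
by move: DL; have [h1|h1] := leP 1 (2 * a); lra.
Qed.

(** * Primes congruent to 1 modulo l *)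

Lemma exists_nonroot (R : idomainType) (q : {poly R}) (x : nat -> R) :
  q != 0 -> injective x -> exists j, q.[x j] != 0.
Proof.
move=> q0 x_inj.
have [/allP h|/allPn[j _ xj]] := boolP (all (fun j => root q (x j)) (iota 0 (size q))).
  have := @max_poly_roots _ q (map x (iota 0 (size q))) q0.
  rewrite size_map size_iota ltnn map_inj_uniq // iota_uniq => max_roots.
  suff: false by []; apply: max_roots => //.
  by apply/allP => _ /mapP[j js ->]; apply: h.
by exists j.
Qed.

(* If the order [d] of [x] modulo [p] were a proper divisor of [l], then [x]
   would be a double root of ['X^l - 1], which is separable modulo [p]. *)
Lemma prime_dvdz_Cyclotomic (p l : nat) (x : int) :
  prime p -> (0 < l)%N -> ~~ (p %| l)%N -> ~~ (p %| x)%Z ->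
  (p %| ('Phi_l).[x])%Z -> (l %| p.-1)%N.
Proof.
move=> p_pr l0 pl px pPhi.
have chF : p \in [pchar 'F_p] by apply: pchar_Fp.
pose y : 'F_p := x%:~R; pose f d := map_poly (intr : int -> 'F_p) 'Phi_d.
have dvdE z : (z%:~R == 0 :> 'F_p) = (p %| z)%Z.
  by rewrite -(dvdz_pcharf chF).
have y0 : y != 0 by rewrite dvdE.
have rootl : (f l).[y] = 0 by apply/eqP; rewrite horner_map dvdE.
have prodf n : (0 < n)%N -> \prod_(d <- divisors n) f d = 'X^n - 1.
  move=> n0; rewrite -rmorph_prod /= prod_Cyclotomic //.
  by rewrite rmorphB /= map_polyXn rmorph1.
have prody n : (0 < n)%N -> \prod_(d <- divisors n) (f d).[y] = y ^+ n - 1.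
  by move=> n0; rewrite -horner_prod prodf // !hornerE.
have yl : y ^+ l = 1.
  apply/eqP; rewrite -subr_eq0 -prody // prodf_seq_eq0; apply/hasP; exists l.
    by rewrite -dvdn_divisors.
  by rewrite rootl eqxx.
have [d d_prim dl] := prim_order_exists l0 yl.
have d0 := prim_order_gt0 d_prim.
suff dE : d = l.
  rewrite -dE (prim_order_dvd d_prim); apply/eqP/(mulfI y0).
  by rewrite -exprS prednK ?prime_gt0 // mulr1; have := expf_card y; rewrite card_Fp.
apply/eqP; apply: contraT => dNl.
have := prody d d0; rewrite (prim_expr_order d_prim) subrr => /eqP.
rewrite prodf_seq_eq0 => /hasP[e]; rewrite -dvdn_divisors // => ed /= rootE.
have eNl : e != l.
  by apply: contraNneq dNl => el; rewrite eqn_dvd dl -el ed.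
(* The derivative of ['X^l - 1] at [y] vanishes because both [f l] and [B] do, yet it equals
   [l * y ^ (l - 1)], nonzero modulo [p]. *)
have := congr1 (fun q => q^`().[y]) (prodf l l0).
rewrite (bigD1_seq l) ?divisors_uniq -?dvdn_divisors //=.
set B := \prod_(i <- _ | _) _; have By : B.[y] = 0.
  apply/eqP; rewrite horner_prod prodf_seq_eq0; apply/hasP; exists e.
    by rewrite -dvdn_divisors // (dvdn_trans ed).
  by rewrite eNl.
rewrite derivM derivB derivXn derivC subr0 !hornerE rootl By.
rewrite mulr0 mul0r addr0 hornerMn hornerXn => /esym/eqP.
rewrite -mulr_natr mulf_eq0 expf_eq0 (negPf y0) andbF /=.
by rewrite -(dvdn_pcharf chF) (negPf pl).
Qed.

(** As in Euclid's proof, [p] is a prime factor of ['Phi_l] at a multiple [x] of [l * N!]. Since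
    ['Phi_l] divides ['X^l - 1], [p] does not divide [x], so it exceeds [N] and does not divide
    [l]. *)
Lemma exists_prime_congr1 (l N : nat) : (0 < l)%N ->
  exists p, [/\ prime p, (N < p)%N & (l %| p.-1)%N].
Proof.
move=> l0; pose f := 'Phi_l.
have f1 : (1 < size f)%N by rewrite size_Cyclotomic ltnS totient_gt0.
have nz (c : int) : f - c%:P != 0.
  rewrite -size_poly_gt0 size_polyDl ?(ltnW f1) // size_polyN.
  by apply: leq_ltn_trans f1; rewrite size_polyC leq_b1.
(* The three factors rule out the values 0, 1 and -1, leaving an absolute value above 1. *)
have [||j] := @exists_nonroot _ (f * (f - 1%:P) * (f - (-1)%:P))
    (fun j => (l * N`! * j)%N%:Z).
- by rewrite !mulf_neq0 ?nz // -size_poly_gt0 ltnW.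
- move=> i j [] /eqP; rewrite eqn_pmul2l ?muln_gt0 ?l0 ?fact_gt0 //.
  by move/eqP.
set x := (_ * j)%N; rewrite !hornerE => fx.
have fx1 : (1 < `|f.[x%:Z]|)%N.
  by move: fx; case: (f.[_]) => [[|[|n]]|[|n]].
have p_pr := pdiv_prime fx1; set p := pdiv _ in p_pr *.
have p_dvd : (p %| f.[x%:Z])%Z by rewrite dvdzE pdiv_dvd.
have px : ~~ (p %| x)%N.
  apply/negP => px; have : (p %| (x%:Z) ^+ l - 1)%Z.
    have := congr1 (horner^~ x%:Z) (prod_Cyclotomic l0).
    rewrite (bigD1_seq l) ?divisors_uniq -?dvdn_divisors //= !hornerE => <-.
    exact: dvdz_mulr.
  have xl : (p %| x%:Z ^+ l)%Z by rewrite dvdz_exp // dvdzE.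
  by rewrite rpredBl // dvdzE dvdn1 absz_nat => /eqP p1; rewrite p1 in p_pr.
exists p; split=> //.
  rewrite ltnNge; apply: contra px => pN.
  by rewrite /x dvdn_mulr // dvdn_mull // dvdn_fact // prime_gt0.
apply: (prime_dvdz_Cyclotomic p_pr l0 _ _ p_dvd).
  by apply: contra px => pl; rewrite /x -mulnA dvdn_mulr.
by rewrite dvdzE.
Qed.

(** * The upper bound *)

(* Some level set of [x |-> x ^ ((p-1)/l)] contains at least a proportion [1/l] of
   the interval [1, M]; its product set lies in a coset of the subgroup of index [l]. *)
Lemma exists_interval_coset (p l M : nat) :
  prime p -> (0 < l)%N -> (l %| p.-1)%N -> (M < p)%N ->
  exists A : {set 'F_p}, [/\ (M <= l * #|A|)%N, (#|sumset A| <= (2 * M).+1)%N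
    & (l * #|prodset A| <= p)%N].
Proof.
move=> p_pr l0 /dvdnP[k pk] Mp; have p1 := prime_gt1 p_pr.
have k0 : (0 < k)%N by case: k pk => //; lia.
pose I : {set 'F_p} := [set n%:R | n : 'I_M.+1 & (0 < n)%N].
pose phi (x : 'F_p) : 'F_p := x ^+ k.
have card_roots (n : nat) (y : 'F_p) : (0 < n)%N -> (#|[set x | x ^+ n == y]| <= n)%N.
  move=> n0; pose q : {poly 'F_p} := 'X^n - y%:P.
  have sq : size q = n.+1 by rewrite size_XnsubC.
  have q0 : q != 0 by rewrite -size_poly_eq0 sq.
  rewrite cardE -ltnS -sq; apply: max_poly_roots => //; last exact: enum_uniq.
  by apply/allP => x; rewrite mem_enum inE /root !hornerE subr_eq0.
have natI (n : 'I_M.+1) : val (n%:R : 'F_p) = n.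
  rewrite /= val_Fp_nat // modn_small //; apply: leq_ltn_trans Mp; exact: leq_ord.
have cI : #|I| = M.
  rewrite card_imset; last by move=> m n /(congr1 val); rewrite !natI => /val_inj.
  have -> : #|[set n : 'I_M.+1 | (0 < n)%N]| = #|[set~ (ord0 : 'I_M.+1)]|.
    by apply: eq_card => n; rewrite !inE lt0n.
  by rewrite cardsC1 card_ord.
have I0 x : x \in I -> x != 0.
  by case/imsetP => n; rewrite inE => n0 ->; rewrite -val_eqE natI -lt0n.
have fermat (x : 'F_p) : x != 0 -> x ^+ p.-1 = 1.
  move=> x0; apply: (mulfI x0); rewrite -exprS prednK ?prime_gt0 // mulr1.
  by have := expf_card x; rewrite card_Fp.
pose Y := [set y : 'F_p | y ^+ l == 1].
pose A (y : 'F_p) := [set x in I | phi x == y].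
have sumA : (\sum_(y in Y) #|A y| = M)%N.
  rewrite -{1}cI -sum1_card.
  under eq_bigr => y _ do rewrite -sum1_card.
  rewrite [RHS](partition_big phi (mem Y)) /=; last first.
    move=> x Ix; have := fermat x (I0 x Ix); rewrite inE /phi -exprM -pk => ->.
    exact: eqxx.
  by apply: eq_bigr => y _; apply: eq_bigl => x; rewrite inE.
have [y Ay] : exists y, (M <= l * #|A y|)%N.
  have [M0|M0] := posnP M; first by exists 0; rewrite M0.
  apply/existsP; apply: contraT => /existsPn h.
  have : (l * M <= l * M.-1)%N; last by rewrite leq_pmul2l //; lia.
  rewrite -{1}sumA big_distrr /=; apply: (@leq_trans (\sum_(z in Y) M.-1)%N).
    by apply: leq_sum => z _; rewrite -ltnS prednK // ltnNge h.
  by rewrite sum_nat_const leq_mul2r card_roots ?orbT.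
exists (A y); split=> //.
- apply: (@leq_trans #|[set (n%:R : 'F_p) | n : 'I_(2 * M).+1]|).
    apply: subset_leq_card; apply/subsetP => _ /imset2P[x x' + + ->].
    rewrite !inE => /andP[/imsetP[m _ ->] _] /andP[/imsetP[n _ ->] _].
    have mn : (m + n < (2 * M).+1)%N by rewrite ltnS mul2n -addnn leq_add // leq_ord.
    by apply/imsetP; exists (Ordinal mn); rewrite //= natrD.
  by apply: leq_trans (leq_imset_card _ _) _; rewrite card_ord.
(* With [k = (p - 1) / l], all products have [k]-th power [y * y], so there are at most [k] of
   them. *)
apply: (@leq_trans (l * k)%N); last by rewrite mulnC -pk leq_pred.
rewrite leq_mul2l; apply/orP; right.
apply: leq_trans (card_roots k (y * y) k0); apply: subset_leq_card.
apply/subsetP => _ /imset2P[x x' + + ->]; rewrite !inE /phi.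
by move=> /andP[_ /eqP xy] /andP[_ /eqP x'y]; rewrite exprMn xy x'y.
Qed.

(** The first hypothesis bounds the infimum over one tail of primes from below, the second the
    infimum over every tail from above. *)
Lemma sum_product_liminfP (R : realType) (alpha c : R) :
  (forall eps, 0 < eps -> exists N, forall p, prime p -> (N <= p)%N ->
     ((c - eps)%:E <= min_ratio alpha p)%E) ->
  (forall eps N, 0 < eps -> exists p, [/\ prime p, (N <= p)%N &
     (min_ratio alpha p <= (c + eps)%:E)%E]) ->
  sum_product_liminf alpha = c%:E.
Proof.
move=> lower upper; rewrite /sum_product_liminf limf_einfE.
apply/eqP; rewrite eq_le; apply/andP; split.
  apply: ge_ereal_sup => _ [V [N _ NV] <-].
  apply/lee_addgt0Pr => eps eps0; have [p [p_pr Np le_p]] := upper eps N eps0.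
  rewrite -EFinD; apply: le_trans le_p.
  by apply: ereal_inf_lbound; exists p => //; apply: NV.
apply/lee_addgt0Pr => eps eps0; have [N ge_N] := lower eps eps0.
rewrite -leeBlDr // -EFinB; apply: le_ereal_sup_tmp.
exists (ereal_inf (min_ratio alpha @` [set p | prime p /\ (N <= p)%N]%classic)%classic).
  by eexists; last reflexivity; exists N.
by apply: le_ereal_inf_tmp => _ [p [p_pr Np] <-]; apply: ge_N.
Qed.

(** For [k] beyond [alpha^-1] the term [2 * k * alpha] is at least [2 * alpha] and 1, hence at least
    the value at 1, so a finite range suffices. *)
Lemma exists_minimum_max (R : archiRealFieldType) (alpha : R) : 0 < alpha ->
  exists2 l : nat, (0 < l)%N & forall k : nat, (0 < k)%N ->
    Num.max (2 * l%:R * alpha) (1 / l%:R) <= Num.max (2 * k%:R * alpha) (1 / k%:R).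
Proof.
move=> alpha0; pose v l := Num.max (2 * l%:R * alpha) (1 / l%:R).
pose L := (Num.trunc alpha^-1).+1.
have L1 : (1 < L.+1)%N by [].
have [|l l0 lmin] := @arg_minP _ R 'I_L.+1 (Ordinal L1) (fun i => 0 < i)%N (fun i => v i).
  by [].
exists l => // k k0; have [kL|kL] := ltnP k L.+1; first exact: (lmin (Ordinal kL)).
apply: le_trans (lmin (Ordinal L1) isT) _; rewrite /v /=.
have h : alpha^-1 < k%:R.
  by apply: lt_le_trans (truncnS_gt _) _; rewrite ler_nat ltnW.
have ka : 1 <= k%:R * alpha by rewrite -ler_pdivrMr // div1r ltW.
have k1 : 1 <= k%:R :> R by rewrite ler1n.
rewrite le_max ge_max; apply/orP; left; apply/andP; split.
  by rewrite ler_pM2r //; lra.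
by rewrite divr1 -mulrA; lra.
Qed.

Lemma sum_product_upper_bound (R : realType) (alpha eps : R) (l N : nat) :
  0 < alpha < 1 -> 0 < eps -> (0 < l)%N ->
  exists p, [/\ prime p, (N <= p)%N & (min_ratio alpha p <=
    (Num.min 1 (Num.max (2 * l%:R * alpha) (1 / l%:R)) + eps)%:E)%E].
Proof.
move=> /andP[alpha0 alpha1] eps0 l0.
set m := Num.max _ _.
have [m1|m1] := leP 1 m.
  (* The whole field is a witness, with ratio at most 1. *)
  have [p Np p_pr] := prime_above N; exists p; split=> //; first exact: ltnW.
  have p0 : 0 < p%:R :> R by rewrite ltr0n prime_gt0.
  apply: (bigmin_inf [set: 'F_p]%SET).
    by rewrite cardsT card_Fp // ler_piMl ?ler0n // ltW.
  rewrite lee_fin ler_pdivrMr //; apply: (@le_trans _ _ (1 * p%:R)).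
    by rewrite mul1r ler_nat geq_max !card_Fp_le.
  by rewrite ler_pM2r // lerDl ltW.
have [p [p_pr]] := exists_prime_congr1 (maxn (maxn N 2) (Num.trunc (3 / eps)).+1) l0.
rewrite !gtn_max => /andP[/andP[Np p2] p_eps] lp; exists p; split=> //; first exact: ltnW.
have p0 : 0 < p%:R :> R by rewrite ltr0n prime_gt0.
have l0' : 0 < l%:R :> R by rewrite ltr0n.
have la : l%:R * alpha < 1 / 2.
  by move: m1; rewrite gt_max => /andP[h _]; lra.
(* Rounding up gives [#|A| >= M / l >= alpha * p]; its cost is [2 * M + 1 <= 2 * l * alpha * p + 3],
   whence the 3 in the size of [p]. *)
pose M := (Num.trunc (l%:R * alpha * p%:R)).+1.
have lap0 : 0 < l%:R * alpha * p%:R by rewrite !mulr_gt0.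
have [M_le M_gt] := trunc_ler (ltW lap0).
have {}M_le : M%:R <= l%:R * alpha * p%:R + 1 by rewrite -natr1 lerD2r.
have {}M_gt : l%:R * alpha * p%:R < M%:R by rewrite -natr1.
have p_eps' : 3 <= eps * p%:R.
  rewrite mulrC -ler_pdivrMr //; apply/ltW/(lt_trans (truncnS_gt _)).
  by rewrite ltr_nat.
have Mp : (M < p)%N.
  rewrite -(ltr_nat R); apply: le_lt_trans M_le _.
  have : l%:R * alpha * p%:R < 1 / 2 * p%:R by rewrite ltr_pM2r.
  have : 2 < p%:R :> R by rewrite (ltr_nat _ 2).
  lra.
have [A [MA sA pA]] := exists_interval_coset p_pr l0 lp Mp.
apply: (bigmin_inf A).
  rewrite -(ler_pM2l l0') mulrA; apply: le_trans (ltW M_gt) _.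
  by rewrite -natrM ler_nat.
rewrite lee_fin ler_pdivrMr // natr_max ge_max; apply/andP; split.
  apply: (@le_trans _ _ (2 * l%:R * alpha * p%:R + 3)).
    apply: (@le_trans _ _ ((2 * M).+1)%:R); first by rewrite ler_nat.
    by rewrite -natr1 natrM; lra.
  by rewrite [leRHS]mulrDl lerD // ler_pM2r // le_max lexx.
apply: (@le_trans _ _ (1 / l%:R * p%:R)).
  by rewrite mulrAC ler_pdivlMr // mul1r mulrC -natrM ler_nat.
by rewrite ler_pM2r // ler_wpDr ?(ltW eps0) // le_max lexx orbT.
Qed.

(** * Combination of the two bounds *)

Local Open Scope classical_set_scope.

Theorem theorem1p1 (R : realType) (alpha : R)
    (alpha_gt0 : 0 < alpha) (alpha_lt1 : alpha < 1) :
  exists m : R,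
    is_minimum [set Num.max (2 * l%:R * alpha) (1 / l%:R) |
                 l in [set l : nat | (0 < l)%N]] m /\
    sum_product_liminf alpha = (Num.min 1 m)%:E.
Proof.
have [l l0 lmin] := exists_minimum_max alpha_gt0.
exists (Num.max (2 * l%:R * alpha) (1 / l%:R)); split.
  by split; [exists l | move=> _ [k k0 <-]; apply: lmin].
apply: sum_product_liminfP => [eps eps0|eps N eps0]; last first.
  by apply: sum_product_upper_bound => //; apply/andP.
have alpha01 : 0 < alpha <= 1 by rewrite alpha_gt0 ltW.
have [N lower] := sum_product_lower_bound alpha01 eps0.
(* The default [+oo] of the minimum is above any bound. The [k] obtained next varies with [A];
   minimality of [l] makes the bound uniform. *)
exists N => p p_pr Np; apply: le_bigmin => [|A Aalpha]; first exact: leey.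
have [k k0 le_k] := lower p p_pr Np A Aalpha.
rewrite lee_fin; apply: le_trans le_k; rewrite lerD2r.
by rewrite le_min ge_min lexx /= ge_min (lmin k k0) orbT.
Qed.
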